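(* Let $c>0$, $D>0$, $k>0$, and let $u(\theta,\varphi,t)$ be the solution described in the context, where the angular power spectrum $\{C_l,\ l=0,1,2,\dots\}$ of the initial field $T$ satisfies \[ \sum_{l=0}^{\infty }(2l+1)^3C_{l}<\infty. \] Then there exists a constant $C$, depending only on $c$, $D$ and $k$, such that for all $t>0$ \[ \|u(\theta ,\varphi ,t+h)-u(\theta ,\varphi ,t)\|_{L_2(\Omega \times\mathbb S^{2})} \le Ch\quad\text{as } h\to 0+. \]
   Context: On the unit sphere with coordinates $(\theta,\varphi)\in[0,\pi)\times[0,2\pi)$ and measure $\sin\theta\,d\theta\,d\varphi$, $Y_{lm}(\theta,\varphi)=d_{lm}e^{im\varphi}P_l^m(\cos\theta)$, $d_{lm}=(-1)^m\big[\frac{(2l+1)(l-m)!}{4\pi(l+m)!}\big]^{1/2}$, are complex spherical harmonics; $\mathbf 0$ denotes $\theta=\varphi=0$. $T=\sum_{l,m}a_{lm}Y_{lm}$ is a real Gaussian isotropic field with $a_{lm}$ complex Gaussian, $a_{lm}=(-1)^ma_{l,-m}$, $\mathbf E a_{lm}=0$, $\mathbf Ea_{lm}\overline{a_{l'm'}}=\delta_l^{l'}\delta_m^{m'}C_l$, independent for $m\ne-m'$. The solution of $\frac1{c^2}u_{tt}+\frac1Du_t=k^2\Delta_{(\theta,\varphi)}u$ ($\Delta_{(\theta,\varphi)}$ the Laplace–Beltrami operator), $u|_{t=0}=T$, $u_t|_{t=0}=0$, is $u(\theta,\varphi,t)=\exp(-\frac{c^2t}{2D})\sum_{l\ge0}\sum_{m=-l}^lY_{lm}(\theta,\varphi)\xi_{lm}(t)$,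 with $\xi_{lm}(t)=\sqrt{\frac{4\pi}{2l+1}}a_{lm}\overline{Y_{l0}(\mathbf 0)}[A_l(t)+B_l(t)]$, $A_l(t)=[\cosh(tK_l)+\frac{c^2}{2DK_l}\sinh(tK_l)]\mathbf 1_{\{l\le l^*\}}$, $B_l(t)=[\cos(tK_l')+\frac{c^2}{2DK_l'}\sin(tK_l')]\mathbf 1_{\{l>l^*\}}$, $K_l=\sqrt{\frac{c^4}{4D^2}-c^2l(l+1)k^2}$, $K_l'=\sqrt{c^2l(l+1)k^2-\frac{c^4}{4D^2}}$, $l^*=\frac{\sqrt{D^2k^2+c^2}-Dk}{2Dk}$ (with $\sinh(tK_l)/K_l:=t$ if $K_l=0$). $\|X\|_{L_2(\Omega\times\mathbb S^2)}=(\mathbf E\int_{\mathbb S^2}|X|^2\sin\theta\,d\theta\,d\varphi)^{1/2}$.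
   Formalization: The constant C may depend on the angular power spectrum as well as on c, D, k (independence of it fails under scaling of C_l), and the coefficient relation is taken as a_lm = (-1)^m times the complex conjugate of a_{l,-m}, as for a real field. *)

(* Defs.v *)
From HB Require Import structures.
From mathcomp Require Import all_boot all_order all_algebra.
From mathcomp Require Import complex.
From mathcomp Require Import all_classical all_reals all_analysis.
Set Implicit Arguments. Unset Strict Implicit. Unset Printing Implicit Defensive.
Import Order.TTheory GRing.Theory Num.Theory.
Import numFieldNormedType.Exports.
Local Open Scope classical_set_scope.
Local Open Scope ring_scope.

Section Defs.
Context {R : realType}.

Definition coshR (x : R) : R := (expR x + expR (- x)) / 2.
Definition sinhR (x : R) : R := (expR x - expR (- x)) / 2.

(* associated Legendre function P_l^m(x), -l <= m <= l, via the Rodrigues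
   formula  P_l^m(x) = (1-x^2)^{m/2}/(2^l l!) d^{l+m}/dx^{l+m} (x^2-1)^l
   (no Condon-Shortley phase: the factor (-1)^m is carried by d_lm). *)
Definition assocLegendre (l : nat) (m : int) (x : R) : R :=
  ((2 ^+ l * (l`!)%:R)^-1) * (Num.sqrt (1 - x ^+ 2)) ^ m *
  ((('X ^+ 2 - 1) ^+ l : {poly R})^`(absz (l%:Z + m))).[x].

Definition dlm (l : nat) (m : int) : R :=
  (-1) ^ m * Num.sqrt (((2 * l + 1)%:R * ((absz (l%:Z - m))`!)%:R) /
                       (4 * pi * ((absz (l%:Z + m))`!)%:R)).

Definition Ylm (l : nat) (m : int) (theta phi : R) : R[i] :=
  ((dlm l m * assocLegendre l m (cos theta)) +i* 0)%C *
  ((cos (m%:~R * phi)) +i* (sin (m%:~R * phi)))%C.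

Variables (c D k : R).

Definition lstar : R := (Num.sqrt (D ^+ 2 * k ^+ 2 + c ^+ 2) - D * k) / (2 * D * k).
Definition K_l (l : nat) : R :=
  Num.sqrt (c ^+ 4 / (4 * D ^+ 2) - c ^+ 2 * (l * l.+1)%:R * k ^+ 2).
Definition K'_l (l : nat) : R :=
  Num.sqrt (c ^+ 2 * (l * l.+1)%:R * k ^+ 2 - c ^+ 4 / (4 * D ^+ 2)).

Definition A_l (l : nat) (t : R) : R :=
  if l%:R <= lstar then
    coshR (t * K_l l) +
    c ^+ 2 / (2 * D) * (if K_l l == 0 then t else sinhR (t * K_l l) / K_l l)
  else 0.
Definition B_l (l : nat) (t : R) : R :=
  if lstar < l%:R then
    cos (t * K'_l l) + c ^+ 2 / (2 * D * K'_l l) * sin (t * K'_l l)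
  else 0.

Definition xi_lm (alm : nat -> int -> R[i]) (l : nat) (m : int) (t : R) : R[i] :=
  ((Num.sqrt (4 * pi / (2 * l + 1)%:R)) +i* 0)%C * alm l m *
  conjc (Ylm l 0 0 0) * ((A_l l t + B_l l t) +i* 0)%C.

Definition u_partial (alm : nat -> int -> R[i]) (L : nat) (theta phi t : R) : R[i] :=
  \sum_(l < L) \sum_(j < (2 * l).+1)
     Ylm l (j%:Z - l%:Z) theta phi * xi_lm alm l (j%:Z - l%:Z) t.

Definition u_sol (alm : nat -> int -> R[i]) (theta phi t : R) : R[i] :=
  ((expR (- (c ^+ 2 * t) / (2 * D))) +i* 0)%C *
  ((lim ((fun L => complex.Re (u_partial alm L theta phi t)) @ \oo)) +i*
   (lim ((fun L => complex.Im (u_partial alm L theta phi t)) @ \oo)))%C.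

End Defs.

Local Open Scope ereal_scope.

Definition esqrt {R : realType} (x : \bar R) : \bar R :=
  if x is r%:E then (Num.sqrt r)%:E else x.

Definition L2norm_OmegaS2 {R : realType} {d} {T : measurableType d}
  (P : probability T R) (X : T -> R -> R -> R[i]) : \bar R :=
  esqrt (\int[P]_w
    (\int[@lebesgue_measure R]_(theta in `[0%R, pi[)
      (\int[@lebesgue_measure R]_(phi in `[0%R, (2 * pi)%R[)
         (((complex.Re (X w theta phi)) ^+ 2 + (complex.Im (X w theta phi)) ^+ 2)
            * sin theta)%:E))).

Definition gaussian_rv {R : realType} {d} {T : measurableType d}
  (P : probability T R) (Y : T -> R) : Prop :=
  exists (mu s : R), (0 <= s)%R /\
    forall A : set R, measurable A ->
      P (Y @^-1` A) = (if s == 0%R then \d_mu A else normal_prob mu s A).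

(* complex Gaussian: (Re Z, Im Z) is a Gaussian vector *)
Definition complex_gaussian {R : realType} {d} {T : measurableType d}
  (P : probability T R) (Z : T -> R[i]) : Prop :=
  forall alpha beta : R,
    gaussian_rv P (fun w => alpha * complex.Re (Z w) + beta * complex.Im (Z w))%R.

Definition indep_complex {R : realType} {d} {T : measurableType d}
  (P : probability T R) (X Y : T -> R[i]) : Prop :=
  forall A B C E : set R, measurable A -> measurable B -> measurable C -> measurable E ->
    P ((fun w => complex.Re (X w)) @^-1` A `&` (fun w => complex.Im (X w)) @^-1` B
       `&` ((fun w => complex.Re (Y w)) @^-1` C `&` (fun w => complex.Im (Y w)) @^-1` E))
    = P ((fun w => complex.Re (X w)) @^-1` A `&` (fun w => complex.Im (X w)) @^-1` B)
      * P ((fun w => complex.Re (Y w)) @^-1` C `&` (fun w => complex.Im (Y w)) @^-1` E).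

Definition valid_lm (l : nat) (m : int) : bool := ((- (l%:Z) <= m) && (m <= l%:Z))%R.

Definition isotropic_gaussian_coeffs {R : realType} {d} {T : measurableType d}
  (P : probability T R) (Cl : nat -> R) (a : nat -> int -> T -> R[i]) : Prop :=
  [/\ (forall l m, valid_lm l m ->
         measurable_fun setT (fun w => complex.Re (a l m w)) /\
         measurable_fun setT (fun w => complex.Im (a l m w)) /\
         complex_gaussian P (a l m)),
      (forall l m, valid_lm l m -> forall w,
         a l m w = (Complex ((-1) ^ m) 0 * conjc (a l (- m) w))%R),
      (forall l m, valid_lm l m ->
         'E_P[fun w => complex.Re (a l m w)] = 0 /\
         'E_P[fun w => complex.Im (a l m w)] = 0),
      (forall l m l' m', valid_lm l m -> valid_lm l' m' ->
         'E_P[fun w => complex.Re (a l m w * conjc (a l' m' w))%R]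
           = (if (l == l') && (m == m') then Cl l else 0%R)%:E /\
         'E_P[fun w => complex.Im (a l m w * conjc (a l' m' w))%R] = 0) &
      (forall l m l' m', valid_lm l m -> valid_lm l' m' ->
         (l, m) != (l', m') -> (l, m) != (l', (- m')%R) ->
         indep_complex P (a l m) (a l' m'))].

(* Main.v *)
Require Import Defs.
From HB Require Import structures.
From mathcomp Require Import all_boot all_order all_algebra.
From mathcomp Require Import complex.
From mathcomp Require Import all_classical all_reals all_analysis.
From mathcomp Require Import measurable_realfun ring lra zify.
Import Order.TTheory GRing.Theory Num.Theory.
Import numFieldNormedType.Exports.
Local Open Scope classical_set_scope.
Local Open Scope ring_scope.

(** Write [Z_l] for the sum over [m] of [a_lm Y_lm].  As [P_l(1) = 1], the
    solution is the sum of the [F_l(t) Z_l] for the damped modes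
    [F_l(t) = exp(- c^2 t / 2D) (A_l(t) + B_l(t))], and the mean value theorem
    gives [|F_l(t+h) - F_l(t)| <= M (2l+1) h] with [M = c^2/D + ck], uniformly
    in [t].  The covariances of the [a_lm] make the [Z_l] orthogonal in
    [L2(Omega x S^2)], with squared norm [(2l+1) C_l] because each [Y_lm] has
    norm 1; so the increments of the partial sums have squared norm at most
    [M^2 h^2] times the sum of the [(2l+1)^3 C_l].

    The solution is only a pointwise limit of its partial sums.  To avoid
    exceptional null sets, the nonnegative terms [h^2 (2l+1)^2 |Z_l|^2] are
    added to the squared increment of the partial sums.  Where their sum
    diverges, so does the penalized sequence; where it converges, the sum of
    the [|Z_l|] converges and the partial sums converge to the solution.
    Hence the squared increment of the solution is everywhere at most the
    lower limit of the penalized sequence, and Fatou's lemma, applied to the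
    three nested integrals, concludes. *)

Set Implicit Arguments.
Unset Strict Implicit.

(** * Derivatives of [(X^2 - 1)^l] *)

(** The derivative keeps a factor [('X - a%:P) ^+ l] and only changes the cofactor, so the next two
    inductions run over an arbitrary [q]. *)
Lemma deriv_XsubC_exp_mul {R : comNzRingType} (a : R) (q : {poly R}) l :
  (('X - a%:P) ^+ l.+1 * q)^`() =
    ('X - a%:P) ^+ l * (q *+ l.+1 + ('X - a%:P) * q^`()).
Proof.
rewrite derivM deriv_exp derivXsubC mul1r /=.
by rewrite exprSr -mulr_natr -[q *+ _]mulr_natr; ring.
Qed.

(** Each derivative removes one factor and, modulo ['X - a%:P], multiplies the cofactor by the
    exponent; the exponents build up the factorial. *)
Lemma horner_derivn_XsubC_exp {R : comNzRingType} (a : R) (q : {poly R}) l :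
  ((('X - a%:P) ^+ l * q)^`(l)).[a] = l`!%:R * q.[a].
Proof.
elim: l q => [|l IH] q; first by rewrite derivn0 expr0 mul1r fact0 mul1r.
rewrite derivSn deriv_XsubC_exp_mul IH !hornerE subrr mul0r addr0.
by rewrite hornerMn factS natrM -[q.[a] *+ _]mulr_natl; ring.
Qed.

Lemma horner_derivn_XsubC_exp_eq0 {R : comNzRingType} (a : R) (q : {poly R}) i l :
  (i < l)%N -> ((('X - a%:P) ^+ l * q)^`(i)).[a] = 0.
Proof.
elim: l i q => [//|l IH] [|i] q.
  by rewrite derivn0 !hornerE subrr exprS !mul0r.
by move=> il; rewrite derivSn deriv_XsubC_exp_mul IH.
Qed.

(** In characteristic zero a vanishing derivative forces a constant. This lets a polynomial identity
    be integrated from the point [a]. *)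
Lemma deriv_eq0_horner_eq0 {R : numFieldType} (p : {poly R}) (a : R) :
  p^`() = 0 -> p.[a] = 0 -> p = 0.
Proof.
move=> dp pa; have E : p = (p`_0)%:P.
  apply/polyP => -[|i]; rewrite coefC //=.
  have /eqP : p^`()`_i = 0 by rewrite dp coef0.
  by rewrite coef_deriv mulrn_eq0 /= => /eqP.
by move: pa; rewrite E hornerC => ->.
Qed.

Section rodrigues.
Context {R : numFieldType}.
Variable l : nat.
Let f : {poly R} := ('X ^+ 2 - 1) ^+ l.
(** At [cos theta] this is [sin theta ^+ 2], the square of the sine factor of the associated
    Legendre functions. *)
Let w : {poly R} := 1 - 'X ^+ 2.

Lemma rodriguesE : f = ('X - 1%:P) ^+ l * ('X + 1) ^+ l.
Proof. by rewrite /f -exprMn polyC1 -[in LHS](expr1n _ 2) subr_sqr. Qed.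

Lemma rodrigues_at1 : (f^`(l)).[1] = l`!%:R * 2 ^+ l.
Proof. by rewrite rodriguesE horner_derivn_XsubC_exp !hornerE. Qed.

Lemma rodrigues_at1_eq0 i : (i < l)%N -> (f^`(i)).[1] = 0.
Proof. by move=> il; rewrite rodriguesE horner_derivn_XsubC_exp_eq0. Qed.

Lemma rodrigues_ode0 : ('X ^+ 2 - 1) * f^`() = (2 * l)%:R * 'X * f.
Proof.
rewrite /f; case: l => [|n]; first by rewrite expr0 -polyC1 derivC mulr0 muln0 !mul0r.
rewrite deriv_exp derivB derivXn -polyC1 derivC polyC1 subr0 /= exprS.
rewrite -[_ *+ n.+1]mulr_natr -[_ *+ 2]mulr_natr expr1 natrM exprS; move: (_ ^+ n) => u; ring.
Qed.

(** This is [rodrigues_ode0] differentiated [n.+1] times; the induction differentiates once more at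
    each step. *)
Lemma rodrigues_ode n : ('X ^+ 2 - 1) * f^`(n.+2) =
  2 * (l%:R - n.+1%:R) * 'X * f^`(n.+1) + n.+1%:R * (2 * l%:R - n%:R) * f^`(n).
Proof.
have D2 : ('X ^+ 2 - 1 : {poly R})^`() = 2 * 'X.
  by rewrite derivB derivXn -polyC1 derivC subr0 /= expr1 mulr_natl.
have Dn (p : {poly R}) (m : nat) : (m%:R * p)^`() = m%:R * p^`().
  by rewrite mulr_natl derivMn mulr_natl.
elim: n => [|n IH].
  have := congr1 (@deriv _) rodrigues_ode0.
  rewrite derivM D2 -mulrA Dn derivM derivX mul1r !derivnS derivn0 => E.
  have -> : ('X^2 - 1) * f^`()^`() = 2 * 'X * f^`() + ('X ^+ 2 - 1) * f^`()^`()
     - 2 * 'X * f^`() by ring.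
  by rewrite E natrM; ring.
have := congr1 (@deriv _) IH.
rewrite derivM D2 -!derivnS => E.
have -> : ('X^2 - 1) * f^`(n.+3) = 2 * 'X * f^`(n.+2) + ('X ^+ 2 - 1) * f^`(n.+3)
     - 2 * 'X * f^`(n.+2) by ring.
rewrite E.
have Dz (p : {poly R}) (a b c : nat) :
    (a%:R * (b%:R - c%:R) * p)^`() = a%:R * (b%:R - c%:R) * p^`().
  by rewrite -!mulrA Dn mulrBl derivB !Dn; ring.
rewrite derivD -(mulrA (2 * _)) Dz -[2 * l%:R]natrM Dz derivM derivX mul1r.
rewrite -!derivnS natrM.
rewrite -(natr1 n.+1) -(natr1 n); ring.
Qed.

(** Legendre's equation in divergence form: in [rodrigues_ode] at index [l + j], the ['X] term
    cancels the derivative of the weight. *)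
Lemma deriv_weight_rodrigues j : (w ^+ j.+1 * f^`(l + j.+1))^`() =
  - ((l + j.+1)%:R * (l%:R - j%:R)) * (w ^+ j * f^`(l + j)).
Proof.
have Dw : w^`() = - (2 * 'X).
  by rewrite derivB derivXn -polyC1 derivC sub0r /= expr1 mulr_natl.
rewrite derivM deriv_exp Dw /= -mulr_natl -derivnS -addnS.
rewrite [w ^+ j.+1]exprSr.
have -> : w ^+ j * w * f^`(l + j.+2) = - w ^+ j * (('X ^+ 2 - 1) * f^`(l + j.+2)).
  by rewrite /w; ring.
rewrite !addnS rodrigues_ode -!natr1 natrD; ring.
Qed.

(** Meant to be integrated: the left side leaves boundary values, which vanish with [w], and the
    right side relates the orders [j.+1] and [j]. *)
Lemma deriv_weight_rodrigues_sqr j :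
  (w ^+ j.+1 * f^`(l + j.+1) * f^`(l + j))^`() =
  w ^+ j.+1 * f^`(l + j.+1) ^+ 2
  - (l + j.+1)%:R * (l%:R - j%:R) * (w ^+ j * f^`(l + j) ^+ 2).
Proof. by rewrite derivM deriv_weight_rodrigues -derivnS -addnS; ring. Qed.

(* This makes [P_l^(-j)] a multiple of [P_l^j]. *)
Lemma weight_rodrigues_reflect i j : (i + j)%N = l ->
  i`!%:R * (w ^+ j * f^`(l + j)) = (-1) ^+ j * (l + j)`!%:R * f^`(i).
Proof.
elim: j i => [|j IH] i.
  by rewrite addn0 => ->; rewrite !expr0 addn0 !mul1r.
rewrite addnS -addSn => E.
apply/eqP; rewrite -subr_eq0; apply/eqP.
(* Both sides have the same derivative by [IH] at [i.+1], and both vanish at 1: the left through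
   [w], the right because [i < l]. *)
apply: (@deriv_eq0_horner_eq0 _ _ 1).
  have Dn (p : {poly R}) (m : nat) : (m%:R * p)^`() = m%:R * p^`().
    by rewrite mulr_natl derivMn mulr_natl.
  have Ds (p : {poly R}) n : ((-1) ^+ n * p)^`() = (-1) ^+ n * p^`().
    by rewrite -signr_odd; case: odd; rewrite ?expr0 ?mul1r // expr1 !mulN1r derivN.
  rewrite derivB Dn deriv_weight_rodrigues -mulrA Ds Dn -derivnS.
  have <- : i.+1%:R = l%:R - j%:R :> {poly R} by rewrite -E natrD addrK.
  rewrite addnS (factS (l + j)) natrM.
  have := IH _ E; rewrite factS natrM => IH'.
  have -> : i`!%:R * (- ((l + j).+1%:R * i.+1%:R) * (w ^+ j * f^`(l + j))) =
    - (l + j).+1%:R * (i.+1%:R * i`!%:R * (w ^+ j * f^`(l + j))) by ring.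
  by rewrite IH' exprS; ring.
rewrite hornerD hornerN !hornerM (@rodrigues_at1_eq0 i); last by rewrite -E addSn ltnS leq_addr.
rewrite horner_exp /w !hornerE subr0 expr1n subrr exprS mul0r /=.
by rewrite !(mul0r, mulr0).
Qed.

(** [f] is monic of degree [l + l], so only its leading term survives that many derivatives. *)
Lemma rodrigues_top : f^`(l + l) = (l + l)`!%:R.
Proof.
have sz2 : size ('X ^+ 2 - 1 : {poly R}) = 3 by exact: size_Xn_sub_1.
have mf : f \is monic.
  by rewrite monic_exp // -polyC1; exact: monicXnsubC.
have szf : size f = (l + l).+1.
  rewrite -(prednK (n := size f)) ?size_poly_gt0 ?monic_neq0 //.
  by rewrite size_exp sz2 mulSn mul1n.
have cf : f`_(l + l) = 1 by move/monicP: mf; rewrite /lead_coef szf.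
apply/polyP => i; rewrite coef_derivn -polyC_natr coefC.
case: i => [|i] /=; first by rewrite addn0 cf ffactnn.
by rewrite nth_default ?mul0rn // szf addnS ltnS leq_addr.
Qed.

(** Integrated over [-1, 1], the left side gives 0; what remains is the Wallis recursion for the
    powers of the weight. *)
Lemma deriv_X_weight : ('X * w ^+ l.+1)^`() =
  (2 * l + 3)%:R * w ^+ l.+1 - (2 * l.+1)%:R * w ^+ l.
Proof.
rewrite derivM derivX mul1r deriv_exp /= derivB derivXn -polyC1 derivC sub0r /= expr1 polyC1.
by rewrite -[X in _ + _ * X]mulr_natl exprSr natrD !natrM -natr1 /w -mulr_natr; ring.
Qed.

End rodrigues.

(** * Integrals in the colatitude *)

Section colatitude.
Context {R : realType}.
Implicit Types p q : {poly R}.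

Lemma continuous_integrable_itvco (f : R -> R) (a b : R) : continuous f ->
  (@lebesgue_measure R).-integrable `[a, b[ (EFin \o f).
Proof.
move=> cf.
have icc : (@lebesgue_measure R).-integrable `[a, b] (EFin \o f).
  apply: continuous_compact_integrable; first exact: segment_compact.
  exact: continuous_subspaceT.
by apply: integrableS icc => // x; exact: subset_itv_co_cc.
Qed.

Lemma continuous_horner_cos p : continuous (fun x : R => p.[cos x]).
Proof.
by move=> x; apply: continuous_comp; [exact: continuous_cos|exact: continuous_horner].
Qed.

Lemma continuous_horner_cos_sin p : continuous (fun x : R => p.[cos x] * sin x).
Proof.
by move=> x; apply: cvgM; [exact: continuous_horner_cos|exact: continuous_sin].
Qed.

(** The substitution x = cos theta makes this the integral of [p] over [-1, 1]; keeping theta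
    matches the measure and the half-open interval of the norm. *)
Definition colat_int p : R :=
  \int[@lebesgue_measure R]_(x in `[0, pi[) (p.[cos x] * sin x).

Lemma colat_intD p q : colat_int (p + q) = colat_int p + colat_int q.
Proof.
rewrite /colat_int -RintegralD //; first by apply: eq_Rintegral => x _; rewrite hornerD mulrDl.
all: by apply: continuous_integrable_itvco; exact: continuous_horner_cos_sin.
Qed.

Lemma colat_intZ (a : R) p : colat_int (a%:P * p) = a * colat_int p.
Proof.
rewrite /colat_int -RintegralZl //.
  by apply: eq_Rintegral => x _; rewrite hornerM hornerC mulrA.
by apply: continuous_integrable_itvco; exact: continuous_horner_cos_sin.
Qed.

Lemma colat_intB p q : colat_int (p - q) = colat_int p - colat_int q.
Proof.
have -> : - q = (-1)%:P * q by rewrite polyCN mulN1r.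
by rewrite colat_intD colat_intZ mulN1r.
Qed.

(** [- p.[cos x]] is a primitive of the integrand, and the cosine runs from 1 to -1. *)
Lemma colat_int_deriv p : colat_int p^`() = p.[1] - p.[-1].
Proof.
rewrite /colat_int Rintegral_itv_bndo_bndc; last first.
  by apply: continuous_integrable_itvco; exact: continuous_horner_cos_sin.
rewrite /Rintegral.
have dF x : is_derive (x : R) (1 : R) (fun x : R => - p.[cos x]) (p^`().[cos x] * sin x).
  have := is_deriveN (is_derive1_comp (is_derive_poly p (cos x)) (is_derive_cos x)).
  by rewrite mulrN opprK.
rewrite (@continuous_FTC2 R _ (fun x : R => - p.[cos x])) //.
- by rewrite cos0 cospi -EFinB /= opprK addrC.
- exact: pi_gt0.
- by apply: continuous_subspaceT; exact: continuous_horner_cos_sin.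
- have cF : continuous (fun x : R => - p.[cos x]).
    by move=> x; apply: cvgN; exact: continuous_horner_cos.
  split.
  + by move=> x _; exact: ex_derive.
  + by apply: cvg_at_right_filter; exact: cF.
  + by apply: cvg_at_left_filter; exact: cF.
- by move=> x _; rewrite derive1E derive_val.
Qed.

Let w : {poly R} := 1 - 'X ^+ 2.
Let f l : {poly R} := ('X ^+ 2 - 1) ^+ l.

Let w1 j : (w ^+ j.+1).[1] = 0.
Proof. by rewrite horner_exp /w !hornerE expr1n subrr exprS mul0r. Qed.

Let wN1 j : (w ^+ j.+1).[-1] = 0.
Proof. by rewrite horner_exp /w !hornerE sqrrN expr1n subrr exprS mul0r. Qed.

Lemma colat_int_weightS l :
  (2 * l + 3)%:R * colat_int (w ^+ l.+1) = (2 * l.+1)%:R * colat_int (w ^+ l).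
Proof.
apply/eqP; rewrite -subr_eq0 -!colat_intZ -colat_intB; apply/eqP.
have /(congr1 colat_int) := @deriv_X_weight R l.
rewrite colat_int_deriv !hornerM w1 wN1 !mulr0 subrr -!polyC_natr.
by move=> <-.
Qed.

Lemma colat_int_weight l :
  (2 * l).+1`!%:R * colat_int (w ^+ l) = 2 * (2 ^+ l * l`!%:R) ^+ 2.
Proof.
elim: l => [|l IH].
  rewrite expr0 -(derivX R) colat_int_deriv !hornerX opprK muln0 fact0.
  by rewrite /= factS fact0; ring.
rewrite mulnS addnC addn2 factS natrM.
have -> : (2 * l).+3%:R = (2 * l + 3)%:R :> R by rewrite addn3.
rewrite -mulrA mulrCA colat_int_weightS factS natrM.
have -> : (2 * l).+2%:R = 2 * l.+1%:R :> R by rewrite -natrM mulnS.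
have -> : 2 * l.+1%:R * (2 * l).+1`!%:R * ((2 * l.+1)%:R * colat_int (w ^+ l)) =
  2 * l.+1%:R * (2 * l.+1)%:R * ((2 * l).+1`!%:R * colat_int (w ^+ l)) by ring.
by rewrite IH factS !natrM (exprS 2 l); ring.
Qed.

Lemma colat_int_rodriguesS l j :
  colat_int (w ^+ j.+1 * (f l)^`(l + j.+1) ^+ 2) =
  (l + j.+1)%:R * (l%:R - j%:R) * colat_int (w ^+ j * (f l)^`(l + j) ^+ 2).
Proof.
apply/eqP; rewrite -subr_eq0 -colat_intZ -colat_intB; apply/eqP.
have /(congr1 colat_int) := @deriv_weight_rodrigues_sqr R l j.
rewrite colat_int_deriv !hornerM w1 wN1 !mul0r subrr.
by rewrite polyCM polyCB !polyC_natr => <-.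
Qed.

(** The induction on [i = l - j] descends from [j = l], where the derivative is the constant of
    [rodrigues_top], through the ratios of [colat_int_rodriguesS]. *)
Lemma colat_int_rodrigues l i j : (i + j)%N = l ->
  i`!%:R * colat_int (w ^+ j * (f l)^`(l + j) ^+ 2) =
  (l + j)`!%:R * (l + l)`!%:R * colat_int (w ^+ l).
Proof.
elim: i j => [|i IH] j.
  rewrite add0n => ->; rewrite fact0 mul1r rodrigues_top.
  rewrite -polyC_natr -polyC_exp mulrC colat_intZ; ring.
rewrite addSnnS => E; have := IH _ E; rewrite colat_int_rodriguesS.
have -> : l%:R - j%:R = i.+1%:R :> R by rewrite -E -addSnnS natrD addrK.
rewrite addnS factS natrM (factS i) (natrM _ i.+1) => IH'.
apply: (@mulfI _ (l + j).+1%:R); first by rewrite pnatr_eq0.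
transitivity (i`!%:R * ((l + j).+1%:R * i.+1%:R * colat_int (w ^+ j * (f l)^`(l + j) ^+ 2))).
  by ring.
by rewrite IH'; ring.
Qed.

End colatitude.

(** * Normalized associated Legendre functions *)

Section legendre.
Context {R : realType}.

Let f l : {poly R} := ('X ^+ 2 - 1) ^+ l.

(** The theta factor of [Ylm] at order [j >= 0], with [sin theta] in place of the square root, which
    makes it continuous on the whole line. Negative orders reduce to it by [Ylm_colat]. *)
Definition colat_fun (l j : nat) (theta : R) : R :=
  dlm l j * ((2 ^+ l * l`!%:R)^-1 * sin theta ^+ j * (f l)^`(l + j).[cos theta]).

Lemma continuous_colat_fun l j : continuous (colat_fun l j).
Proof.
move=> x; apply: cvgM; first exact: cvg_cst.
apply: cvgM; last exact: continuous_horner_cos.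
apply: cvgM; first exact: cvg_cst.
by apply: (@continuous_comp _ _ _ sin (fun y => y ^+ j));
  [exact: continuous_sin|exact: exprn_continuous].
Qed.

Lemma sqrt_1Bcos2 (theta : R) : theta \in `]0, pi[ ->
  Num.sqrt (1 - cos theta ^+ 2) = sin theta.
Proof.
move=> h; rewrite -(cos2Dsin2 theta) addrAC subrr add0r sqrtr_sqr ger0_norm //.
by rewrite ltW // sin_gt0_pi // -in_itv.
Qed.

(** For negative orders [weight_rodrigues_reflect] trades the derivative of order [l - j] for the
    weighted one of order [l + j]; [dlm] absorbs the factorials and a sign remains. The proof
    divides by [sin theta], hence the open interval. *)
Lemma Ylm_colat (l : nat) (m : int) (theta : R) :
  valid_lm l m -> theta \in `]0, pi[ ->
  dlm l m * assocLegendre l m (cos theta) =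
  (if m < 0 then (-1) ^+ absz m else 1) * colat_fun l (absz m) theta.
Proof.
move=> /andP[ml lm] h; rewrite /assocLegendre sqrt_1Bcos2 //.
have s0 : sin theta != 0 by rewrite gt_eqF // sin_gt0_pi // -in_itv.
case: m ml lm => [j|j] ml lm.
  by rewrite mul1r.
rewrite NegzE /= /colat_fun.
set J := j.+1.
have Jl : (J <= l)%N by move: ml; rewrite NegzE lerN2.
set i := (l - J)%N.
have ijl : (i + J)%N = l by rewrite subnK.
have -> : absz (l%:Z + - J%:Z) = i by rewrite -ijl PoszD addrK.
have H : i`!%:R * (sin theta ^+ J) ^+ 2 * (f l)^`(l + J).[cos theta] =
    (-1) ^+ J * (l + J)`!%:R * (f l)^`(i).[cos theta].
  have := @weight_rodrigues_reflect R l i J ijl.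
  move=> /(congr1 (horner^~ (cos theta))).
  have -> : (-1) ^+ J = ((-1) ^+ J)%:P :> {poly R} by rewrite polyC_exp polyCN.
  rewrite -!polyC_natr !hornerM !hornerC horner_exp hornerD hornerN hornerXn hornerC.
  have -> : 1 - cos theta ^+ 2 = sin theta ^+ 2.
    by rewrite -(cos2Dsin2 theta) addrAC subrr add0r.
  by rewrite exprAC mulrA.
have n0 n : n`!%:R != 0 :> R by rewrite pnatr_eq0 -lt0n fact_gt0.
(* Changing the sign of the order inverts the factorial quotient under the root, so the root itself
   changes by that whole quotient. *)
have dJ : dlm l (- J%:Z) = dlm l J%:Z * ((l + J)`!%:R / i`!%:R) :> R.
  rewrite /dlm opprK.
  have -> : absz (l%:Z - J%:Z) = i by rewrite -ijl PoszD addrK.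
  rewrite -PoszD absz_nat -exprnN invr_sign -[RHS]mulrA; congr (_ * _).
  have r0 : 0 <= (l + J)`!%:R / i`!%:R :> R by rewrite divr_ge0.
  rewrite -[X in _ = _ * X](ger0_norm r0) -sqrtr_sqr -sqrtrM; last first.
    by rewrite divr_ge0 // ?mulr_ge0 // pi_ge0.
  congr Num.sqrt; have : @pi R != 0 by rewrite gt_eqF ?pi_gt0.
  by move: (@pi R) => p p0; field; rewrite !n0 p0.
rewrite dJ -exprnN.
have -> : (f l)^`(i).[cos theta] = (-1) ^+ J * i`!%:R / (l + J)`!%:R *
    (sin theta ^+ J) ^+ 2 * (f l)^`(l + J).[cos theta].
  apply: (mulfI (n0 (l + J)%N)); apply: (mulfI (_ : (-1) ^+ J != 0 :> R)).
    by rewrite signr_eq0.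
  rewrite mulrA -H.
  have -> : (-1) ^+ J * ((l + J)`!%:R * ((-1) ^+ J * i`!%:R / (l + J)`!%:R *
     (sin theta ^+ J) ^+ 2 * (f l)^`(l + J).[cos theta])) =
     ((-1) ^+ J) ^+ 2 * ((l + J)`!%:R / (l + J)`!%:R) * (i`!%:R *
     (sin theta ^+ J) ^+ 2 * (f l)^`(l + J).[cos theta]) by ring.
  by rewrite sqrr_sign divff // !mul1r.
move: (_.[cos theta]) (dlm _ _) ((-1) ^+ J) (_ ^+ l * _)^-1 => G d e q.
have sJ0 : sin theta ^+ J != 0 by rewrite expf_neq0.
move: (sin theta ^+ J) sJ0 => s {}s0.
by field; rewrite s0 !n0.
Qed.

(** The constant in [dlm] is made for this: all factorials cancel, and the value is the inverse of
    the [2 * pi] that the longitude contributes. *)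
Lemma Rintegral_colat_fun_sqr l j : (j <= l)%N ->
  \int[@lebesgue_measure R]_(x in `[0, pi[) (colat_fun l j x ^+ 2 * sin x) = (2 * pi)^-1.
Proof.
move=> jl.
pose i := (l - j)%N.
have ijl : (i + j)%N = l by rewrite subnK.
pose c := (dlm l j * (2 ^+ l * l`!%:R)^-1) ^+ 2 : R.
transitivity (colat_int (c%:P * ((1 - 'X ^+ 2) ^+ j * (f l)^`(l + j) ^+ 2))).
  apply: eq_Rintegral => x _; congr (_ * _).
  rewrite !hornerM hornerC !horner_exp hornerD hornerN hornerXn -polyC1 hornerC.
  have -> : 1 - cos x ^+ 2 = sin x ^+ 2.
    by rewrite -(cos2Dsin2 x) addrAC subrr add0r.
  rewrite /colat_fun /c exprAC !exprMn !mulrA; congr (_ * _ * _ * _).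
rewrite colat_intZ.
have n0 n : n`!%:R != 0 :> R by rewrite pnatr_eq0 -lt0n fact_gt0.
have H1 := @colat_int_rodrigues R l i j ijl.
have H2 := @colat_int_weight R l.
have {H2}-> : colat_int ((1 - 'X ^+ 2) ^+ j * (f l)^`(l + j) ^+ 2) =
   (l + j)`!%:R / i`!%:R * 2 * (2 ^+ l * l`!%:R) ^+ 2 / (2 * l + 1)%:R.
  apply: (mulfI (n0 i)); rewrite H1.
  apply: (mulfI (n0 (2 * l).+1)); rewrite [LHS]mulrCA H2 factS natrM addn1.
  by rewrite mul2n addnn; field; rewrite n0 nat1r pnatr_eq0.
rewrite /c /dlm.
have -> : absz (l%:Z - j%:Z) = i by rewrite -ijl PoszD addrK.
rewrite !exprMn sqr_sqrtr; last first.
  by rewrite divr_ge0 // ?mulr_ge0 // pi_ge0.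
rewrite -PoszD absz_nat -exprnP sqrr_sign mul1r.
have : @pi R != 0 by rewrite gt_eqF ?pi_gt0.
have : (2 * l + 1)%:R != 0 :> R by rewrite pnatr_eq0 addn1.
have : 2 ^+ l != 0 :> R by rewrite expf_neq0 // pnatr_eq0.
move: (@pi R) l`!%:R i`!%:R (l + j)`!%:R (2 * l + 1)%:R (2 ^+ l) (n0 l) (n0 i) (n0 (l + j)%N).
move=> p x y z n q x0 y0 z0 q0 n0' p0; field.
by rewrite p0 n0' y0 x0 q0 z0.
Qed.

(** Amounts to [P_l(1) = 1], which is [rodrigues_at1] divided by [2 ^+ l] and the factorial. *)
Lemma Ylm00 l : Ylm l 0 0 0 = (Num.sqrt ((2 * l + 1)%:R / (4 * pi)) +i* 0 : R[i])%C.
Proof.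
rewrite /Ylm /assocLegendre cos0 mulr0 cos0 sin0 expr0z addr0 absz_nat.
have n0 : l`!%:R != 0 :> R by rewrite pnatr_eq0 -lt0n fact_gt0.
rewrite rodrigues_at1 mulr1 [l`!%:R * _]mulrC mulVf; last first.
  by rewrite mulf_neq0 // expf_neq0 // pnatr_eq0.
rewrite /dlm expr0z mul1r addr0 ?subr0 ?oppr0 ?addr0 !absz_nat [4 * pi * _]mulrC invfM.
rewrite mulrA -[X in Num.sqrt (X / _)]mulrA divff // mulr1.
by apply/eqP; rewrite eq_complex /= !(mulr1, mulr0, mul0r, subr0, addr0) !eqxx.
Qed.

End legendre.

(** * Damped modes *)

Section damped_modes.
Context {R : realType}.

(** The intermediate point of the mean value theorem lies strictly beyond [s >= 0], so the bound on
    [df] is asked at positive arguments only. *)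
Lemma is_derive_le_lipschitz (f df : R -> R) (M s t : R) :
  (forall x, is_derive x (1 : R) f (df x)) ->
  (forall x, 0 < x -> `|df x| <= M) -> 0 <= s -> s <= t ->
  `|f t - f s| <= M * (t - s).
Proof.
move=> fdf dfM s0 st.
have cf : {within `[s, t], continuous f}.
  apply: continuous_subspaceT => x.
  by apply: differentiable_continuous; apply/derivable1_diffP; case: (fdf x).
case: ltgtP st => // [st _|->]; last by rewrite !subrr normr0 mulr0.
have [x /[!in_itv]/= /andP[sx _] ->] := @MVT R f df s t st (fun x _ => fdf x) cf.
have ts : 0 <= t - s by rewrite subr_ge0 ltW.
by rewrite normrM (ger0_norm ts) ler_wpM2r // dfM // (le_lt_trans s0).
Qed.

Lemma ler_norm_sin (x : R) : 0 <= x -> `|sin x| <= x.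
Proof.
move=> x0; have := @is_derive_le_lipschitz sin cos 1 0 x (@is_derive_sin R)
  (fun y _ => cos_max y) (lexx 0) x0.
by rewrite sin0 !subr0 mul1r.
Qed.

(** This makes the Lipschitz constants below independent of time: the damping absorbs a linear
    growth in [x]. *)
Lemma ler_mul_expRN (x : R) : x * expR (- x) <= 1.
Proof.
rewrite expRN ler_pdivrMr ?expR_gt0 // mul1r.
by apply: le_trans (expR_ge1Dx x); rewrite lerDr.
Qed.

Lemma sinhR_ge0 (x : R) : 0 <= x -> 0 <= sinhR x.
Proof.
by move=> x0; rewrite /sinhR divr_ge0 // subr_ge0 ler_expR; lra.
Qed.

(** Factor out [expR x]: what remains is half of [1 - expR (- (2 * x))], at most [x]. *)
Lemma sinhR_le (x : R) : sinhR x <= x * expR x.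
Proof.
rewrite /sinhR ler_pdivrMr //.
have -> : - x = x + (- (2 * x)) by ring.
have := ler_wpM2l (expR_ge0 x) (expR_ge1Dx (- (2 * x))).
by rewrite expRD; lra.
Qed.

Lemma coshR_ge0 (x : R) : 0 <= coshR x.
Proof. by rewrite /coshR divr_ge0 // addr_ge0 // expR_ge0. Qed.

Lemma coshR_le (x : R) : 0 <= x -> coshR x <= expR x.
Proof.
move=> x0; rewrite /coshR ler_pdivrMr //.
have : expR (- x) <= expR x by rewrite ler_expR; lra.
lra.
Qed.

Lemma is_derive_lin (K x : R) : is_derive x (1 : R) (fun t : R => t * K) K.
Proof.
have := @is_deriveM _ _ id (cst K) x (1:R) _ _ (is_derive_id x (1:R)) (is_derive_cst K x (1:R)).
by move=> /is_derive_eq; apply; rewrite scaler0 add0r /= /GRing.scale /= mulr1.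
Qed.

Lemma is_derive_expR_lin (b x : R) :
  is_derive x (1 : R) (fun t => expR (t * b)) (b * expR (x * b)).
Proof.
have := @is_derive1_comp R expR (fun t => t * b) x _ _ (is_derive_expR (x * b))
  (is_derive_lin b x).
by rewrite mulrC.
Qed.

(** Treats both regimes at once: [C], [S] are cosh and sinh / K with [q = K ^+ 2], or cos and sin /
    K with [q = - K ^+ 2]. The damping cancels the terms in [C]. *)
Lemma is_derive_damped (b q : R) (C S : R -> R) (x : R) :
  is_derive x (1 : R) C (q * S x) -> is_derive x (1 : R) S (C x) ->
  is_derive x (1 : R) (fun t => expR (t * - b) * (C t + b * S t))
    (expR (x * - b) * ((q - b ^+ 2) * S x)).
Proof.
move=> hC hS.
have h1 := is_derive_expR_lin (- b) x.
have h2 := is_deriveD hC (is_deriveZ b hS).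
have := is_deriveM h1 h2.
move=> /is_derive_eq; apply.
rewrite /GRing.scale /= /GRing.scale /=.
have -> : (C + b \*: S) x = C x + b * S x by [].
ring.
Qed.

Lemma is_derive_coshR_lin (K x : R) :
  is_derive x (1 : R) (fun t => coshR (t * K)) (K * sinhR (x * K)).
Proof.
have := is_deriveZ 2^-1 (is_deriveD (is_derive_expR_lin K x) (is_derive_expR_lin (- K) x)).
have -> : (2^-1 \*: ((fun t : R => expR (t * K)) + (fun t => expR (t * - K)))) =
   (fun t => coshR (t * K)).
  by apply/funext => t /=; rewrite /coshR -mulrN; rewrite /GRing.scale /=  mulrC.
move=> /is_derive_eq; apply; rewrite /sinhR -(mulrN x) /GRing.scale /=; ring.
Qed.

Lemma is_derive_sinhR_lin (K x : R) :
  is_derive x (1 : R) (fun t => sinhR (t * K)) (K * coshR (x * K)).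
Proof.
have := is_deriveZ 2^-1 (is_deriveB (is_derive_expR_lin K x) (is_derive_expR_lin (- K) x)).
have -> : (2^-1 \*: ((fun t : R => expR (t * K)) - (fun t => expR (t * - K)))) =
   (fun t => sinhR (t * K)).
  by apply/funext => t /=; rewrite /sinhR -mulrN; rewrite /GRing.scale /=  mulrC.
move=> /is_derive_eq; apply; rewrite /coshR -(mulrN x) /GRing.scale /=; ring.
Qed.

Definition sinhc (K t : R) := if K == 0 then t else sinhR (t * K) / K.

Lemma sinhc_ge0 (K t : R) : 0 <= K -> 0 <= t -> 0 <= sinhc K t.
Proof.
move=> K0 t0; rewrite /sinhc; case: eqVneq => // _.
by rewrite divr_ge0 // sinhR_ge0 // mulr_ge0.
Qed.

Lemma sinhc_le (K t : R) : 0 <= K -> 0 <= t -> sinhc K t <= t * expR (t * K).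
Proof.
move=> K0 t0; rewrite /sinhc; case: eqVneq => [->|Kn0].
  by rewrite mulr0 expR0 mulr1.
have Kp : 0 < K by rewrite lt_neqAle eq_sym Kn0.
by rewrite ler_pdivrMr // (le_trans (sinhR_le _)) // mulrAC.
Qed.

Lemma is_derive_sinhc (K x : R) :
  is_derive x (1 : R) (sinhc K) (coshR (x * K)).
Proof.
rewrite /sinhc; case: eqVneq => [->|K0].
  by rewrite mulr0 /coshR oppr0 expR0 divff //; exact: is_derive_id.
have := is_deriveZ K^-1 (is_derive_sinhR_lin K x).
have -> : (K^-1 \*: (fun t : R => sinhR (t * K))) = (fun t => sinhR (t * K) / K).
  by apply/funext => t /=; rewrite /GRing.scale /=  mulrC.
by move=> /is_derive_eq; apply; rewrite /GRing.scale /= mulrA mulVf // mul1r.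
Qed.

Definition over_mode (b K t : R) := expR (t * - b) * (coshR (t * K) + b * sinhc K t).

(** The derivative is [(K ^+ 2 - b ^+ 2) * sinhc K x] times the damping. As
    [sinhc K x <= x * expR (x * K)], its size is at most [b + K] times [y * expR (- y)] for
    [y = (b - K) * x], hence at most [2 * b]. *)
Lemma over_mode_lipschitz (b K s t : R) : 0 <= K -> K <= b -> 0 <= s -> s <= t ->
  `|over_mode b K t - over_mode b K s| <= 2 * b * (t - s).
Proof.
move=> K0 Kb s0 st.
have := @is_derive_le_lipschitz (over_mode b K)
  (fun x => expR (x * - b) * ((K ^+ 2 - b ^+ 2) * sinhc K x)) (2 * b) s t.
apply; [|clear s t s0 st|exact: s0|exact: st].
  move=> x; apply: is_derive_damped; last exact: is_derive_sinhc.
  apply: is_derive_eq (is_derive_coshR_lin K x) _.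
  rewrite /sinhc; case: eqVneq => [->|Kn0]; first by rewrite expr2 !mul0r.
  by field.
move=> x x0.
have S0 := sinhc_ge0 K0 (ltW x0); have S1 := sinhc_le K0 (ltW x0).
have E0 := expR_ge0 (x * - b).
rewrite normrM (ger0_norm E0) normrM (ger0_norm S0) distrC ger0_norm; last first.
  by rewrite subr_ge0 lerXn2r // nnegrE //; apply: le_trans Kb.
have bK : 0 <= b ^+ 2 - K ^+ 2.
  by rewrite subr_ge0 lerXn2r // nnegrE //; apply: le_trans Kb.
apply: le_trans (_ : expR (x * - b) * ((b ^+ 2 - K ^+ 2) * (x * expR (x * K))) <= _).
  by rewrite ler_wpM2l // ler_wpM2l.
have -> : expR (x * - b) * ((b ^+ 2 - K ^+ 2) * (x * expR (x * K))) =
    (b + K) * ((b - K) * x * expR (- ((b - K) * x))).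
  have -> : - ((b - K) * x) = x * - b + x * K by ring.
  by rewrite expRD; ring.
apply: le_trans (ler_wpM2l (addr_ge0 (le_trans K0 Kb) K0) (ler_mul_expRN ((b - K) * x))) _.
by rewrite mulr1 mulr_natl mulr2n lerD2l.
Qed.

(** Serves the convergence of the series in [l] at a fixed time, so growth in [t] is harmless while
    uniformity in [K] matters. *)
Lemma over_mode_bound (b K t : R) : 0 <= K -> K <= b -> 0 <= t ->
  `|over_mode b K t| <= 1 + b * t.
Proof.
move=> K0 Kb t0; rewrite /over_mode.
have b0 := le_trans K0 Kb.
have S0 := sinhc_ge0 K0 t0; have S1 := sinhc_le K0 t0.
have C0 := coshR_ge0 (t * K); have C1 := coshR_le (mulr_ge0 t0 K0).
have E0 := expR_ge0 (t * - b).
rewrite ger0_norm; last by rewrite mulr_ge0 // addr_ge0 // mulr_ge0.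
have Kb' : expR (t * K) <= expR (t * b) by rewrite ler_expR ler_wpM2l.
apply: le_trans (_ : expR (t * - b) * (expR (t * b) * (1 + b * t)) <= _).
  rewrite ler_wpM2l //.
  have : b * sinhc K t <= b * (t * expR (t * b)).
    rewrite ler_wpM2l // (le_trans S1) // ler_wpM2l //.
  lra.
by rewrite mulrA -expRD mulrN addNr expR0 mul1r.
Qed.

Definition under_mode (b K t : R) := expR (t * - b) * (cos (t * K) + b / K * sin (t * K)).

(** Up to sign the derivative is [(K ^+ 2 + b ^+ 2) * sin (x * K) / K], damped. The [K ^+ 2] part is
    at most [K]; in the [b ^+ 2] part, [sin (x * K) / K] is at most [x] in size and [ler_mul_expRN]
    leaves [b]. *)
Lemma under_mode_lipschitz (b K s t : R) : 0 <= K -> 0 <= b -> 0 <= s -> s <= t ->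
  `|under_mode b K t - under_mode b K s| <= (b + K) * (t - s).
Proof.
move=> K0 b0 s0 st; have [->|Kn0] := eqVneq K 0.
  (* [b / 0 = 0] leaves only the exponential *)
  rewrite addr0 /under_mode !mulr0 cos0 sin0 invr0 !mulr0 !addr0 !mulr1.
  apply: (@is_derive_le_lipschitz _ _ _ _ _ (is_derive_expR_lin (- b))) => // x x0.
  rewrite normrM normrN (ger0_norm b0) (ger0_norm (expR_ge0 _)) ler_piMr //.
  by rewrite -expR0 ler_expR mulrN oppr_le0 mulr_ge0 // ltW.
have Kp : 0 < K by rewrite lt_neqAle eq_sym Kn0.
pose g t := expR (t * - b) * (cos (t * K) + b * (K^-1 * sin (t * K))).
have gE u : under_mode b K u = g u by rewrite /under_mode /g mulrA.
rewrite !gE; apply: (@is_derive_le_lipschitz g (fun x => expR (x * - b) *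
  ((- K ^+ 2 - b ^+ 2) * (K^-1 * sin (x * K))))) => //.
  move=> x; apply: (@is_derive_damped b (- K ^+ 2) (fun t => cos (t * K))
    (fun t => K^-1 * sin (t * K))).
    apply: is_derive_eq (@is_derive1_comp R cos (fun t => t * K) x _ _
      (is_derive_cos (x * K)) (is_derive_lin K x)) _.
    by field.
  apply: is_derive_eq (is_deriveZ K^-1 (@is_derive1_comp R sin (fun t => t * K) x _ _
    (is_derive_sin (x * K)) (is_derive_lin K x))) _.
  by rewrite /GRing.scale /=; field.
move=> x x0.
have E0 := expR_ge0 (x * - b).
have E1 : expR (x * - b) <= 1.
  by rewrite -expR0 ler_expR mulrN oppr_le0 mulr_ge0 // ltW.
have s1 := sin_max (x * K); have sx := ler_norm_sin (mulr_ge0 (ltW x0) (ltW Kp)).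
have -> : expR (x * - b) * ((- K ^+ 2 - b ^+ 2) * (K^-1 * sin (x * K))) =
  - (expR (x * - b) * (K * sin (x * K)) + b * (b * expR (- (b * x))) * (K^-1 * sin (x * K))).
  have -> : x * - b = - (b * x) by ring.
  by field.
rewrite normrN (le_trans (ler_normD _ _)) // [b + K]addrC lerD //.
  rewrite normrM (ger0_norm E0) normrM (gtr0_norm Kp).
  have : K * `|sin (x * K)| <= K by rewrite ler_piMr.
  by move=> /(le_trans _); apply; rewrite ler_piMl // mulr_ge0.
have E2 := expR_ge0 (- (b * x)).
rewrite normrM (ger0_norm (mulr_ge0 b0 (mulr_ge0 b0 E2))) normrM gtr0_norm ?invr_gt0 //.
apply: le_trans (_ : b * (b * expR (- (b * x))) * x <= _).
  apply: ler_wpM2l; first by rewrite !mulr_ge0.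
  by rewrite mulrC ler_pdivrMr.
rewrite -[leRHS]mulr1 -mulrA ler_wpM2l //.
by rewrite mulrAC; exact: ler_mul_expRN.
Qed.

Lemma under_mode_bound (b K t : R) : 0 <= K -> 0 <= b -> 0 <= t ->
  `|under_mode b K t| <= 1 + b * t.
Proof.
move=> K0 b0 t0; rewrite /under_mode normrM (ger0_norm (expR_ge0 _)).
have E0 := expR_ge0 (t * - b).
have E1 : expR (t * - b) <= 1.
  by rewrite -expR0 ler_expR mulrN oppr_le0 mulr_ge0.
apply: le_trans (_ : `|cos (t * K) + b / K * sin (t * K)| <= _).
  by rewrite ler_piMl.
rewrite (le_trans (ler_normD _ _)) // lerD ?cos_max //.
have [->|Kn0] := eqVneq K 0; first by rewrite invr0 mulr0 mul0r normr0 mulr_ge0.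
have Kp : 0 < K by rewrite lt_neqAle eq_sym Kn0.
rewrite -mulrA normrM (ger0_norm b0) ler_wpM2l // normrM gtr0_norm ?invr_gt0 //.
by rewrite mulrC ler_pdivrMr // ler_norm_sin // mulr_ge0.
Qed.

Variables (c D k : R).
Hypotheses (c0 : 0 < c) (D0 : 0 < D) (k0 : 0 < k).

Definition mode (l : nat) (t : R) : R :=
  expR (- (c ^+ 2 * t) / (2 * D)) * (A_l c D k l t + B_l c D k l t).

Let b := c ^+ 2 / (2 * D).

Let b_ge0 : 0 <= b. Proof. by rewrite divr_ge0 ?sqr_ge0 // mulr_ge0 // ltW. Qed.

Let modeE l : mode l =
  if l%:R <= lstar c D k then over_mode b (K_l c D k l) else under_mode b (K'_l c D k l).
Proof.
apply/funext => t; rewrite /mode /A_l /B_l ltNge.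
have -> : - (c ^+ 2 * t) / (2 * D) = t * - b by rewrite /b; field; rewrite gt_eqF.
case: ifPn => _ /=; first by rewrite addr0.
rewrite add0r /under_mode; congr (_ * (_ + _ * _)).
by rewrite /b invfM mulrA.
Qed.

(** [Num.sqrt] is monotone and 0 on negative arguments, so the bound holds on both sides of
    [lstar]. *)
Let K_l_le l : K_l c D k l <= b.
Proof.
rewrite /K_l -[leRHS]ger0_norm // -sqrtr_sqr ler_wsqrtr //.
have -> : c ^+ 4 / (4 * D ^+ 2) = b ^+ 2 by rewrite /b; field; rewrite gt_eqF.
by rewrite gerBl mulr_ge0 ?sqr_ge0 // mulr_ge0 ?sqr_ge0.
Qed.

Let K'_l_le l : K'_l c D k l <= c * k * l.+1%:R.
Proof.
have h : 0 <= c * k * l.+1%:R by rewrite !mulr_ge0 // ltW.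
rewrite /K'_l -[leRHS]ger0_norm // -sqrtr_sqr ler_wsqrtr //.
have -> : c ^+ 4 / (4 * D ^+ 2) = b ^+ 2 by rewrite /b; field; rewrite gt_eqF.
rewrite (le_trans (_ : _ <= c ^+ 2 * (l * l.+1)%:R * k ^+ 2)) ?gerBl ?sqr_ge0 //.
have -> : (c * k * l.+1%:R) ^+ 2 = c ^+ 2 * (l.+1 * l.+1)%:R * k ^+ 2.
  by rewrite natrM; ring.
by rewrite ler_wpM2r ?sqr_ge0 // ler_wpM2l ?sqr_ge0 // ler_nat leq_mul.
Qed.

(** The constant [c ^+ 2 / D + c * k = 2 * b + c * k] dominates both slopes: [2 * b] below [lstar],
    and [b + c * k * l.+1] above it, where [l.+1 <= 2 * l + 1]. *)
Lemma mode_lipschitz l s t : 0 <= s -> s <= t ->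
  `|mode l t - mode l s| <= (c ^+ 2 / D + c * k) * (2 * l + 1)%:R * (t - s).
Proof.
move=> s0 st; have bE : c ^+ 2 / D = 2 * b by rewrite /b; field; rewrite gt_eqF.
have ck : 0 <= c * k by rewrite mulr_ge0 // ltW.
have n1 : 1 <= (2 * l + 1)%:R :> R by rewrite ler1n addn1.
have n2 : l.+1%:R <= (2 * l + 1)%:R :> R by rewrite ler_nat addn1 ltnS leq_pmull.
rewrite modeE bE; case: ifPn => _.
  apply: le_trans (over_mode_lipschitz _ (K_l_le l) s0 st) _; first exact: sqrtr_ge0.
  rewrite ler_wpM2r ?subr_ge0 // (@le_trans _ _ (2 * b + c * k)) ?lerDl //.
  by rewrite ler_peMr // addr_ge0 // mulr_ge0.
apply: le_trans (under_mode_lipschitz _ b_ge0 s0 st) _; first exact: sqrtr_ge0.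
rewrite ler_wpM2r ?subr_ge0 // mulrDl lerD //.
  rewrite -[leLHS]mulr1 ler_pM // ler_peMl //; lra.
by apply: le_trans (K'_l_le l) _; rewrite ler_wpM2l.
Qed.

Lemma mode_bound l t : 0 <= t -> `|mode l t| <= 1 + c ^+ 2 / (2 * D) * t.
Proof.
move=> t0; rewrite modeE; case: ifPn => _.
  by apply: over_mode_bound => //; exact: sqrtr_ge0.
by apply: under_mode_bound => //; exact: sqrtr_ge0.
Qed.

End damped_modes.

(** * Iterated integrals *)

Section integral_complements.
Context {d} {T : measurableType d} {R : realType} (mu : {measure set T -> \bar R}).
Local Open Scope ereal_scope.

(* The integral of a nonnegative function is the supremum over the simple
   functions below it, so that monotonicity holds without measurability. *)
Lemma ge0_le_integral_nonmeasurable (D : set T) (f g : T -> \bar R) :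
  (forall x, D x -> 0 <= f x) -> (forall x, D x -> f x <= g x) ->
  \int[mu]_(x in D) f x <= \int[mu]_(x in D) g x.
Proof.
move=> f0 fg; rewrite !ge0_integralE //; last first.
  by move=> x Dx; apply: le_trans (fg _ Dx); exact: f0.
apply: le_ereal_sup => _ [h /= hf <-]; exists h => //= x.
apply: le_trans (hf x) _; rewrite /patch; case: ifPn => // /set_mem; exact: fg.
Qed.

Lemma EFin_RintegralE (D : set T) (f : T -> R) : measurable D ->
  mu.-integrable D (EFin \o f) ->
  \int[mu]_(x in D) (f x)%:E = (\int[mu]_(x in D) f x)%R%:E.
Proof. by move=> mD fi; rewrite /Rintegral fineK //; exact: integrable_fin_num. Qed.

Lemma limn_einf_le (u : (\bar R)^nat) (B : \bar R) :
  (forall n, u n <= B) -> limn_einf u <= B.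
Proof.
move=> uB; rewrite limn_einf_lim; apply: lime_le; first exact: is_cvg_einfs.
apply: nearW => n; apply: le_trans (uB n).
by apply: ereal_inf_lbound; exists n => /=.
Qed.

(** Fatou's lemma is applied to the [g n], and [f] is compared with their lower limit by
    monotonicity alone. This suits the increment of the solution, whose measurability is not
    established. *)
Lemma fatou_nonmeasurable (D : set T) (f : T -> \bar R) (g : nat -> T -> R) :
  measurable D -> (forall n, mu.-integrable D (EFin \o g n)) ->
  (forall x, D x -> 0 <= f x) ->
  (forall n x, D x -> (0 <= g n x)%R) ->
  (forall x, D x -> f x <= limn_einf (fun n => (g n x)%:E)) ->
  \int[mu]_(x in D) f x <= limn_einf (fun n => (\int[mu]_(x in D) g n x)%R%:E).
Proof.
move=> mD gi f0 g0 fg.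
apply: le_trans (ge0_le_integral_nonmeasurable f0 fg) _.
apply: le_trans (@fatou _ _ _ mu D mD (fun n x => (g n x)%:E) _ _) _.
- by move=> n; apply: (measurable_int mu); exact: gi.
- by move=> n x Dx; rewrite lee_fin g0.
- rewrite (_ : (fun n => _) = (fun n => (\int[mu]_(x in D) g n x)%R%:E)) //.
  by apply/funext => n; rewrite EFin_RintegralE.
Qed.

End integral_complements.

Section iterated_integral.
Context {d1 d2 d3} {T1 : measurableType d1} {T2 : measurableType d2}
  {T3 : measurableType d3} {R : realType}.
Variables (m1 : {measure set T1 -> \bar R}) (m2 : {measure set T2 -> \bar R})
  (m3 : {measure set T3 -> \bar R}).
Variables (D1 : set T1) (D2 : set T2) (D3 : set T3).
Hypotheses (mD1 : measurable D1) (mD2 : measurable D2) (mD3 : measurable D3).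
Implicit Types g : T1 -> T2 -> T3 -> R.

(** Integrability is recorded at every level because each inner integral is the next integrand; this
    makes nested integrals, in the order of the norm, linear. *)
Definition has_iterated_integral g (v : R) :=
  [/\ forall x y, D1 x -> D2 y -> m3.-integrable D3 (EFin \o g x y),
      forall x, D1 x -> m2.-integrable D2 (EFin \o (fun y => \int[m3]_(z in D3) g x y z)),
      m1.-integrable D1
        (EFin \o (fun x => \int[m2]_(y in D2) \int[m3]_(z in D3) g x y z)) &
      \int[m1]_(x in D1) \int[m2]_(y in D2) \int[m3]_(z in D3) g x y z = v].

Lemma has_iterated_integral_eq g g' v :
  (forall x y z, D1 x -> D2 y -> D3 z -> g x y z = g' x y z) ->
  has_iterated_integral g v -> has_iterated_integral g' v.
Proof.
move=> gg' [g3 g2 g1 gv].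
have e3 x y : D1 x -> D2 y ->
    \int[m3]_(z in D3) g x y z = \int[m3]_(z in D3) g' x y z.
  by move=> Dx Dy; apply: eq_Rintegral => z /set_mem Dz; exact: gg'.
have e2 x : D1 x -> \int[m2]_(y in D2) \int[m3]_(z in D3) g x y z =
    \int[m2]_(y in D2) \int[m3]_(z in D3) g' x y z.
  by move=> Dx; apply: eq_Rintegral => y /set_mem Dy; exact: e3.
split.
- move=> x y Dx Dy; apply: eq_integrable (g3 x y Dx Dy) => // z /set_mem Dz /=.
  by rewrite gg'.
- move=> x Dx; apply: eq_integrable (g2 x Dx) => // y /set_mem Dy /=.
  by rewrite e3.
- by apply: eq_integrable g1 => // x /set_mem Dx /=; rewrite e2.
- by rewrite -gv; apply: eq_Rintegral => x /set_mem Dx; rewrite e2.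
Qed.

Lemma has_iterated_integralD g g' v v' :
  has_iterated_integral g v -> has_iterated_integral g' v' ->
  has_iterated_integral (fun x y z => g x y z + g' x y z) (v + v').
Proof.
move=> [g3 g2 g1 <-] [h3 h2 h1 <-].
have e3 x y : D1 x -> D2 y -> \int[m3]_(z in D3) (g x y z + g' x y z) =
    \int[m3]_(z in D3) g x y z + \int[m3]_(z in D3) g' x y z.
  by move=> Dx Dy; rewrite RintegralD //; [exact: g3|exact: h3].
have e2 x : D1 x -> \int[m2]_(y in D2) \int[m3]_(z in D3) (g x y z + g' x y z) =
    \int[m2]_(y in D2) \int[m3]_(z in D3) g x y z +
    \int[m2]_(y in D2) \int[m3]_(z in D3) g' x y z.
  move=> Dx; rewrite -RintegralD //; [|exact: g2|exact: h2].
  by apply: eq_Rintegral => y /set_mem Dy; exact: e3.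
split.
- move=> x y Dx Dy.
  apply: eq_integrable (integrableD mD3 (g3 x y Dx Dy) (h3 x y Dx Dy)) => // z _.
- move=> x Dx; apply: eq_integrable (integrableD mD2 (g2 x Dx) (h2 x Dx)) => //.
  by move=> y /set_mem Dy /=; rewrite e3 // EFinD.
- apply: eq_integrable (integrableD mD1 g1 h1) => // x /set_mem Dx /=.
  by rewrite e2 // EFinD.
- rewrite -RintegralD //.
  by apply: eq_Rintegral => x /set_mem Dx; rewrite e2.
Qed.

Lemma has_iterated_integralM (f : T1 -> R) (a : T2 -> R) (b : T3 -> R) :
  m1.-integrable D1 (EFin \o f) -> m2.-integrable D2 (EFin \o a) ->
  m3.-integrable D3 (EFin \o b) ->
  has_iterated_integral (fun x y z => f x * a y * b z)
    ((\int[m1]_(x in D1) f x) * (\int[m2]_(y in D2) a y) * (\int[m3]_(z in D3) b z)).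
Proof.
move=> fi ai bi.
have e3 x y : \int[m3]_(z in D3) (f x * a y * b z) =
    f x * a y * \int[m3]_(z in D3) b z by rewrite RintegralZl.
pose Ib := \int[m3]_(z in D3) b z.
have e2 x : \int[m2]_(y in D2) \int[m3]_(z in D3) (f x * a y * b z) =
    f x * ((\int[m2]_(y in D2) a y) * Ib).
  under eq_Rintegral do rewrite e3 -mulrA (mulrC (a _)) mulrA.
  by rewrite RintegralZl // -mulrA (mulrC Ib).
have i1 x : m2.-integrable D2 (EFin \o (fun y => \int[m3]_(z in D3) (f x * a y * b z))).
  apply: eq_integrable (integrableZl mD2 (f x * Ib) ai) => // y _ /=.
  by rewrite e3 -EFinM mulrAC.
split => //.
- move=> x y _ _; apply: eq_integrable (integrableZl mD3 (f x * a y) bi) => //.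
- apply: eq_integrable (integrableZl mD1 ((\int[m2]_(y in D2) a y) * Ib) fi) => // x _ /=.
  by rewrite e2 -EFinM mulrC.
- under eq_Rintegral do rewrite e2 mulrC.
  by rewrite RintegralZl // mulrC mulrA.
Qed.

Lemma has_iterated_integralZ (c : R) g v : has_iterated_integral g v ->
  has_iterated_integral (fun x y z => c * g x y z) (c * v).
Proof.
move=> [g3 g2 g1 <-].
have e3 x y : D1 x -> D2 y -> \int[m3]_(z in D3) (c * g x y z) =
    c * \int[m3]_(z in D3) g x y z.
  by move=> Dx Dy; rewrite RintegralZl //; exact: g3.
have e2 x : D1 x -> \int[m2]_(y in D2) \int[m3]_(z in D3) (c * g x y z) =
    c * \int[m2]_(y in D2) \int[m3]_(z in D3) g x y z.
  move=> Dx; rewrite -RintegralZl //; [|exact: g2].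
  by apply: eq_Rintegral => y /set_mem Dy; exact: e3.
split.
- move=> x y Dx Dy.
  by apply: eq_integrable (integrableZl mD3 c (g3 x y Dx Dy)) => // z _.
- move=> x Dx; apply: eq_integrable (integrableZl mD2 c (g2 x Dx)) => //.
  by move=> y /set_mem Dy /=; rewrite e3 // EFinM.
- apply: eq_integrable (integrableZl mD1 c g1) => // x /set_mem Dx /=.
  by rewrite e2 // EFinM.
- rewrite -RintegralZl //.
  by apply: eq_Rintegral => x /set_mem Dx; rewrite e2.
Qed.

Lemma has_iterated_integral0 : has_iterated_integral (fun _ _ _ => 0) 0.
Proof.
have i0 d (T : measurableType d) (m : {measure set T -> \bar R}) (D : set T) :
    m.-integrable D (EFin \o (fun _ : T => 0)) by exact: integrable0.
have r0 d (T : measurableType d) (m : {measure set T -> \bar R}) (D : set T) :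
    \int[m]_(x in D) (0 : R) = 0 by rewrite /Rintegral integral0.
split.
- by move=> x y _ _; exact: i0.
- move=> x _; rewrite r0; exact: i0.
- under eq_fun do rewrite r0; rewrite r0; exact: i0.
- by rewrite !r0.
Qed.

Lemma has_iterated_integral_sum (I : Type) (s : seq I)
    (g : I -> T1 -> T2 -> T3 -> R) (v : I -> R) :
  (forall i, has_iterated_integral (g i) (v i)) ->
  has_iterated_integral (fun x y z => \sum_(i <- s) g i x y z) (\sum_(i <- s) v i).
Proof.
move=> gv; elim: s => [|i s IH].
  rewrite big_nil; apply: has_iterated_integral_eq has_iterated_integral0.
  by move=> x y z _ _ _; rewrite big_nil.
rewrite big_cons; apply: has_iterated_integral_eq (has_iterated_integralD (gv i) IH).
by move=> x y z _ _ _; rewrite big_cons.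
Qed.

(** Fatou is applied from the outermost integral inwards: at each level the inner integrals of [G n]
    are the approximating sequence, integrable by [has_iterated_integral]. *)
Lemma iterated_fatou (X : T1 -> T2 -> T3 -> \bar R)
    (G : nat -> T1 -> T2 -> T3 -> R) (v : nat -> R) (B : R) :
  (forall n, has_iterated_integral (G n) (v n)) ->
  (forall n, v n <= B) ->
  (forall n x y z, D1 x -> D2 y -> D3 z -> 0 <= G n x y z) ->
  (forall x y z, D1 x -> D2 y -> D3 z -> (0 <= X x y z)%E) ->
  (forall x y z, D1 x -> D2 y -> D3 z ->
     (X x y z <= limn_einf (fun n => (G n x y z)%:E))%E) ->
  (\int[m1]_(x in D1) \int[m2]_(y in D2) \int[m3]_(z in D3) X x y z <= B%:E)%E.
Proof.
move=> GI vB G0 X0 XG.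
apply: le_trans (limn_einf_le (u := EFin \o v) _); last first.
  by move=> n; rewrite lee_fin.
have -> : EFin \o v = fun n =>
    (\int[m1]_(x in D1) \int[m2]_(y in D2) \int[m3]_(z in D3) G n x y z)%:E.
  by apply/funext => n /=; have [_ _ _ ->] := GI n.
apply: fatou_nonmeasurable => //.
- by move=> n; have [_ _] := GI n.
- move=> x Dx; apply: integral_ge0 => y Dy; apply: integral_ge0 => z Dz; exact: X0.
- move=> n x Dx; apply: Rintegral_ge0 => y Dy; apply: Rintegral_ge0 => z Dz; exact: G0.
move=> x Dx; apply: fatou_nonmeasurable => //.
- by move=> n; have [_ /(_ x Dx)] := GI n.
- move=> y Dy; apply: integral_ge0 => z Dz; exact: X0.
- move=> n y Dy; apply: Rintegral_ge0 => z Dz; exact: G0.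
move=> y Dy; apply: fatou_nonmeasurable => //.
- by move=> n; have [/(_ x y Dx Dy)] := GI n.
- move=> z Dz; exact: X0.
- move=> n z Dz; exact: G0.
move=> z Dz; exact: XG.
Qed.

End iterated_integral.

(** * Penalized series *)

Section weighted_series.
Context {R : realType}.
Implicit Types x y p : nat -> R.

Lemma telescope_inv_series n :
  series (fun l => (l.+1 * l.+2)%:R^-1) n = 1 - n.+1%:R^-1 :> R.
Proof.
elim: n => [|n IH]; first by rewrite /series /= big_geq // invr1 subrr.
rewrite seriesSr IH natrM -(natr1 n.+1).
have : n.+1%:R + 1 != 0 :> R by rewrite natr1 pnatr_eq0.
have : n.+1%:R != 0 :> R by rewrite pnatr_eq0.
by move: n.+1%:R => z z0 z1; field; rewrite z0 z1.
Qed.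

Lemma is_cvg_telescope_inv : cvgn (series (fun l => (l.+1 * l.+2)%:R^-1) : nat -> R).
Proof.
apply: nondecreasing_is_cvgn.
  by apply/nondecreasing_seqP => n; rewrite seriesSr lerDl invr_ge0.
by exists 1 => _ [n _ <-]; rewrite telescope_inv_series gerBl invr_ge0.
Qed.

(** With [r = (l + 1)(l + 2)], [|z| <= r * z ^+ 2 + r^-1]. Here [r] is at most twice the squared
    weight, and the inverses of [r] have a telescoping sum. *)
Lemma is_cvg_weighted_sqr x y p (M : R) :
  cvgn (series (fun l => (2 * l + 1)%:R ^+ 2 * (x l ^+ 2 + y l ^+ 2))) ->
  (forall l, `|p l| <= M) -> cvgn (series (fun l => p l * x l)).
Proof.
move=> cq pM; apply: normed_cvg.
have M0 : 0 <= M by apply: le_trans (pM 0%N).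
have amgm (r z : R) : 0 < r -> `|z| <= r * z ^+ 2 + r^-1.
  move=> r0.
  have -> : r * z ^+ 2 + r^-1 = r * (`|z| - r^-1) ^+ 2 + 2 * `|z|.
    by rewrite -(real_normK (num_real z)); field; rewrite gt_eqF.
  have := mulr_ge0 (ltW r0) (sqr_ge0 (`|z| - r^-1)).
  have := normr_ge0 z; lra.
apply: (@series_le_cvg _ _ (fun l => M *
    (2 * ((2 * l + 1)%:R ^+ 2 * (x l ^+ 2 + y l ^+ 2)) + (l.+1 * l.+2)%:R^-1))).
- by move=> l /=; exact: normr_ge0.
- move=> l; rewrite mulr_ge0 // addr_ge0 ?invr_ge0 // mulr_ge0 // mulr_ge0 ?sqr_ge0 //.
  by rewrite addr_ge0 // sqr_ge0.
- move=> l /=; rewrite normrM ler_pM //.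
  set r := (l.+1 * l.+2)%:R; have r0 : 0 < r :> R by rewrite ltr0n.
  apply: le_trans (_ : r * x l ^+ 2 + r^-1 <= _).
    exact: amgm.
  rewrite lerD2r mulrA ler_pM ?sqr_ge0 ?(ltW r0) ?lerDl ?sqr_ge0 //.
  by rewrite -natrX -natrM ler_nat; nia.
- rewrite [X in series X](_ : _ = M *: (2 *: (fun l => (2 * l + 1)%:R ^+ 2 *
    (x l ^+ 2 + y l ^+ 2)) + (fun l => (l.+1 * l.+2)%:R^-1))) //.
  apply: is_cvg_seriesZ; apply: is_cvg_seriesD; last exact: is_cvg_telescope_inv.
  exact: is_cvg_seriesZ.
Qed.

Lemma le_limn_einf_penalized x y p (A B h s : R) : 0 < h -> 0 <= s ->
  let q l := (2 * l + 1)%:R ^+ 2 * (x l ^+ 2 + y l ^+ 2) in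
  (cvgn (series q) -> series (fun l => p l * x l) @ \oo --> A /\
     series (fun l => p l * y l) @ \oo --> B) ->
  (((A ^+ 2 + B ^+ 2) * s)%:E <= limn_einf (fun n =>
     (((series (fun l => p l * x l) n ^+ 2 + series (fun l => p l * y l) n ^+ 2)
       + h ^+ 2 * series q n) * s)%:E))%E.
Proof.
move=> h0 s0 q cvAB.
have q0 l : 0 <= q l by rewrite mulr_ge0 ?sqr_ge0 // addr_ge0 // sqr_ge0.
have ndq : {homo series q : n m / (n <= m)%N >-> n <= m}.
  by apply/nondecreasing_seqP => n; rewrite seriesSr lerDl.
(* At [s = 0], the value of [sin theta] at the pole, both sides are 0; the penalty could not force
   divergence there. *)
move: s0; rewrite le_eqVlt => /predU1P[<-|s0].
  rewrite mulr0; under [X in limn_einf X]eq_fun do rewrite mulr0.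
  by rewrite (cvg_limn_einf_sup (cvg_cst 0%:E)).
have h20 : 0 < h ^+ 2 by rewrite exprn_gt0.
(* If [series q] diverges, the penalty alone exceeds every [a], so the lower limit is infinite. *)
have [cq|dq] := pselect (cvgn (series q)); last first.
  rewrite (_ : limn_einf _ = +oo%E) ?leey //.
  apply: (cvg_limn_einf_sup _).1; apply/cvgeryP; apply/cvgryPge => a.
  have /cvgryPge/(_ (a / (h ^+ 2 * s))) := nondecreasing_dvgn_lt ndq dq.
  apply: filterS => n; rewrite ler_pdivrMr ?mulr_gt0 // => /le_trans; apply.
  rewrite mulrCA mulrA ler_wpM2r ?(ltW s0) // lerDr.
  by rewrite addr_ge0 // sqr_ge0.
have [cA cB] := cvAB cq.
(* Otherwise everything converges, and the limit exceeds the left side by the nonnegative limiting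
   penalty. *)
set u := (X in limn_einf X).
have cu : u @ \oo --> ((A ^+ 2 + B ^+ 2 + h ^+ 2 * limn (series q)) * s)%:E.
  apply: cvg_EFin; first by apply: nearW.
  apply: cvgM; last exact: cvg_cst.
  apply: cvgD; last by apply: cvgM; [exact: cvg_cst|exact: cq].
  by apply: cvgD; apply: cvgM.
rewrite (cvg_limn_einf_sup cu).1 lee_fin ler_wpM2r ?(ltW s0) // lerDl mulr_ge0 ?(ltW h20) //.
apply: limr_ge => //; apply: nearW => n; apply: sumr_ge0 => i _; exact: q0.
Qed.

End weighted_series.

(** * Orthogonality of the harmonic components *)

Section second_moments.
Context {R : realType} {d} {T : measurableType d} (P : probability T R).
Variables (Cl : nat -> R) (a : nat -> int -> T -> R[i]).
Hypothesis Ha : isotropic_gaussian_coeffs P Cl a.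

Let re l m w := complex.Re (a l m w).
Let im l m w := complex.Im (a l m w).

Let measurable_re l m : valid_lm l m -> measurable_fun setT (re l m).
Proof. by case: Ha => H _ _ _ _ /H[]. Qed.

Let measurable_im l m : valid_lm l m -> measurable_fun setT (im l m).
Proof. by case: Ha => H _ _ _ _ /H[_ []]. Qed.

Let second_moment l m : valid_lm l m ->
  (\int[P]_w (re l m w ^+ 2 + im l m w ^+ 2)%:E = (Cl l)%:E)%E.
Proof.
case: Ha => _ _ _ H _ v; have [+ _] := H l m l m v v.
rewrite !eqxx unlock => <-; apply: eq_integral => w _; congr EFin.
by rewrite /re /im; case: (a l m w) => x y /=; ring.
Qed.

Lemma spectrum_ge0 l : 0 <= Cl l.
Proof.
have v : valid_lm l 0 by rewrite /valid_lm oppr_le0 andbb le0z_nat.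
by rewrite -lee_fin -(second_moment v) integral_ge0 // => w _; rewrite lee_fin addr_ge0 // sqr_ge0.
Qed.

Let integrable_sqr l m : valid_lm l m ->
  P.-integrable setT (EFin \o (fun w => re l m w ^+ 2 + im l m w ^+ 2)).
Proof.
move=> v; apply/integrableP; split.
  apply/measurable_EFinP; apply: measurable_funD; apply: measurable_funX.
    exact: measurable_re.
  exact: measurable_im.
rewrite (_ : (\int[P]_w _ = (Cl l)%:E)%E) ?ltry //.
rewrite -(second_moment v); apply: eq_integral => w _ /=.
by rewrite ger0_norm // addr_ge0 // sqr_ge0.
Qed.

(** Integrability of the mixed products comes from domination by the two finite second moments. *)
Let integrable_dominated l m l' m' (f : T -> R) : valid_lm l m -> valid_lm l' m' ->
  measurable_fun setT f ->
  (forall w, `|f w| <= (re l m w ^+ 2 + im l m w ^+ 2) + (re l' m' w ^+ 2 + im l' m' w ^+ 2)) ->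
  P.-integrable setT (EFin \o f).
Proof.
move=> v v' mf fle.
apply: le_integrable (integrableD measurableT (integrable_sqr v) (integrable_sqr v')) => //.
  exact/measurable_EFinP.
move=> w _ /=; rewrite lee_fin; apply: le_trans (fle w) _; exact: ler_norm.
Qed.

Let Re_mul_conj l m l' m' w : complex.Re (a l m w * conjc (a l' m' w)) =
  re l m w * re l' m' w + im l m w * im l' m' w.
Proof. by rewrite /re /im; case: (a l m w) (a l' m' w) => x y [x' y'] /=; ring. Qed.

Let Im_mul_conj l m l' m' w : complex.Im (a l m w * conjc (a l' m' w)) =
  im l m w * re l' m' w - re l m w * im l' m' w.
Proof. by rewrite /re /im; case: (a l m w) (a l' m' w) => x y [x' y'] /=; ring. Qed.

Let amgm (x y x' y' : R) : `|x * x' + y * y'| <= x ^+ 2 + y ^+ 2 + (x' ^+ 2 + y' ^+ 2).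
Proof.
have h1 := sqr_ge0 (x - x'); have h2 := sqr_ge0 (y - y').
have h3 := sqr_ge0 (x + x'); have h4 := sqr_ge0 (y + y').
have := sqr_ge0 x; have := sqr_ge0 x'; have := sqr_ge0 y; have := sqr_ge0 y'.
by rewrite ler_norml; move: h1 h2 h3 h4; rewrite !sqrrB !sqrrD => *; apply/andP; split; lra.
Qed.

Lemma coeff_covariance_re l m l' m' : valid_lm l m -> valid_lm l' m' ->
  P.-integrable setT (EFin \o (fun w => complex.Re (a l m w * conjc (a l' m' w)))) /\
  \int[P]_w complex.Re (a l m w * conjc (a l' m' w)) =
    if (l == l') && (m == m') then Cl l else 0.
Proof.
move=> v v'; split; last first.
  case: Ha => _ _ _ H _; have [+ _] := H l m l' m' v v'.
  by rewrite unlock /Rintegral => ->.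
apply: (integrable_dominated v v').
  under eq_fun do rewrite Re_mul_conj.
  by apply: measurable_funD; apply: measurable_funM;
    (exact: measurable_re || exact: measurable_im).
by move=> w; rewrite Re_mul_conj; exact: amgm.
Qed.

Lemma coeff_covariance_im l m l' m' : valid_lm l m -> valid_lm l' m' ->
  P.-integrable setT (EFin \o (fun w => complex.Im (a l m w * conjc (a l' m' w)))) /\
  \int[P]_w complex.Im (a l m w * conjc (a l' m' w)) = 0.
Proof.
move=> v v'; split; last first.
  case: Ha => _ _ _ H _; have [_] := H l m l' m' v v'.
  by rewrite unlock /Rintegral => ->.
apply: (integrable_dominated v v').
  under eq_fun do rewrite Im_mul_conj.
  by apply: measurable_funB; apply: measurable_funM;
    (exact: measurable_re || exact: measurable_im).
move=> w; rewrite Im_mul_conj -mulrN.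
have := amgm (im l m w) (re l m w) (re l' m' w) (- im l' m' w).
by rewrite sqrrN addrC [X in _ <= X + _]addrC.
Qed.

End second_moments.

Section harmonic_components.
Context {R : realType}.

(** The [Z_l] of the overview; the shift of [j] by [l] makes [m] run from [- l] to [l]. *)
Definition harm {T : Type} (a : nat -> int -> T -> R[i]) l (w : T) (theta phi : R) : R[i] :=
  \sum_(j < (2 * l).+1) Ylm l (j%:Z - l%:Z) theta phi * a l (j%:Z - l%:Z) w.

Lemma Re_sum (I : Type) (s : seq I) (f : I -> R[i]) :
  complex.Re (\sum_(i <- s) f i) = \sum_(i <- s) complex.Re (f i).
Proof. by apply: (@big_morph _ _ _ 0 +%R 0 +%R) => // -[x y] [x' y']. Qed.

Lemma Im_sum (I : Type) (s : seq I) (f : I -> R[i]) :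
  complex.Im (\sum_(i <- s) f i) = \sum_(i <- s) complex.Im (f i).
Proof. by apply: (@big_morph _ _ _ 0 +%R 0 +%R) => // -[x y] [x' y']. Qed.

End harmonic_components.

Section harmonic_orthogonality.
Context {R : realType} {d} {T : measurableType d} (P : probability T R).
Variables (Cl : nat -> R) (a : nat -> int -> T -> R[i]).
Hypothesis Ha : isotropic_gaussian_coeffs P Cl a.
Let leb := @lebesgue_measure R.
Let Dth : set (measurableTypeR R) := `[0, pi[.
Let Dph : set (measurableTypeR R) := `[0, (2 * pi)[.
Local Notation iterated := (has_iterated_integral P leb leb setT Dth Dph).

Let lam l m (theta : R) := dlm l m * assocLegendre l m (cos theta).

Let integrable_lam l m l' m' : valid_lm l m -> valid_lm l' m' ->
  leb.-integrable Dth (EFin \o (fun theta => lam l m theta * lam l' m' theta * sin theta)).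
Proof.
move=> v v'.
pose s (m : int) : R := if m < 0 then (-1) ^+ absz m else 1.
pose g theta := s m * s m' *
  (colat_fun l (absz m) theta * colat_fun l' (absz m') theta * sin theta).
have cg : continuous g.
  move=> x; apply: cvgM; first exact: cvg_cst.
  apply: cvgM; last exact: continuous_sin.
  by apply: cvgM; exact: continuous_colat_fun.
apply: eq_integrable (continuous_integrable_itvco 0 pi cg) => //.
(* [Ylm_colat] covers the open interval; at the pole the factor [sin theta] makes both sides 0. *)
move=> x /set_mem /=; rewrite in_itv /= => /andP[]; rewrite le_eqVlt => /predU1P[<- _|x0 xpi].
  by rewrite /g sin0 !mulr0.
have xi : x \in `]0, pi[ by rewrite in_itv /= x0.
by rewrite /lam !Ylm_colat // /g -/(s m) -/(s m'); congr EFin; ring.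
Qed.

Let Rintegral_lam_sqr l m : valid_lm l m ->
  \int[leb]_(theta in Dth) (lam l m theta * lam l m theta * sin theta) = (2 * pi)^-1.
Proof.
move=> v; have ml : (absz m <= l)%N.
  move: v => /andP[]; case: m => j /=; first by rewrite lez_nat.
  by rewrite NegzE lerN2 lez_nat.
rewrite -(Rintegral_colat_fun_sqr (R:=R) ml); apply: eq_Rintegral.
move=> x /set_mem; rewrite /Dth /= in_itv /= => /andP[]; rewrite le_eqVlt => /predU1P[<- _|x0 xpi].
  by rewrite sin0 !mulr0.
have xi : x \in `]0, pi[ by rewrite in_itv /= x0.
rewrite /lam !Ylm_colat //; congr (_ * _).
case: ifPn => _; last by rewrite !mul1r expr2.
by rewrite mulrACA -expr2 sqrr_sign mul1r expr2.
Qed.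

(** The two phases combine into the angle [(m - m') * phi], which leaves two products of separated
    variables, as [has_iterated_integralM] requires. *)
Let Re_cross l m l' m' theta phi w :
  complex.Re (Ylm l m theta phi * a l m w * conjc (Ylm l' m' theta phi * a l' m' w)) * sin theta =
  complex.Re (a l m w * conjc (a l' m' w)) * (lam l m theta * lam l' m' theta * sin theta)
    * cos ((m - m')%:~R * phi) +
  -1 * (complex.Im (a l m w * conjc (a l' m' w)) * (lam l m theta * lam l' m' theta * sin theta)
    * sin ((m - m')%:~R * phi)).
Proof.
rewrite /Ylm -/(lam l m theta) -/(lam l' m' theta).
rewrite intrD intrN mulrBl cosB sinB.
by case: (a l m w) (a l' m' w) => x y [x' y'] /=; ring.
Qed.

Let integrable_trig (f : R -> R) (m : int) : continuous f ->
  leb.-integrable Dph (EFin \o (fun phi => f (m%:~R * phi))).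
Proof.
move=> cf.
have c : continuous (f \o (fun y : R => m%:~R * y)).
  by move=> x; apply: continuous_comp; [exact: mulrl_continuous|exact: cf].
exact: (continuous_integrable_itvco 0 (2 * pi) c).
Qed.

(** The factor in [w] is a covariance, zero unless the indices agree; then the theta and phi factors
    [(2 * pi)^-1] and [2 * pi] cancel. *)
Lemma iterated_Ylm l m l' m' : valid_lm l m -> valid_lm l' m' ->
  iterated (fun w theta phi =>
    complex.Re (Ylm l m theta phi * a l m w * conjc (Ylm l' m' theta phi * a l' m' w)) * sin theta)
    (if (l == l') && (m == m') then Cl l else 0).
Proof.
move=> v v'.
have [ire vre] := coeff_covariance_re Ha v v'.
have [iim vim] := coeff_covariance_im Ha v v'.
have il := integrable_lam v v'.
have mD1 : measurable Dth by exact: measurable_itv.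
have mD2 : measurable Dph by exact: measurable_itv.
have H1 := has_iterated_integralM (@measurableT _ T) mD1 mD2 ire il
  (integrable_trig (m - m') (@continuous_cos R)).
have H2 := has_iterated_integralM (@measurableT _ T) mD1 mD2 iim il
  (integrable_trig (m - m') (@continuous_sin R)).
have := has_iterated_integralD (@measurableT _ T) mD1 mD2 H1
  (has_iterated_integralZ (@measurableT _ T) mD1 mD2 (-1) H2).
rewrite vre vim !mul0r mulr0 addr0.
set V := (V in iterated _ V -> _).
have -> : V = if (l == l') && (m == m') then Cl l else 0.
  rewrite /V; case: ifPn => [/andP[/eqP <- /eqP <-]|_]; last by rewrite !mul0r.
  rewrite Rintegral_lam_sqr // subrr.
  under eq_Rintegral do rewrite mul0r cos0.
  rewrite Rintegral_cst //= lebesgue_measure_itv /= lte_fin mulr_gt0 ?pi_gt0 //=.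
  by rewrite subr0 mul1r -mulrA mulVf ?mulr1 // mulf_neq0 ?gt_eqF ?pi_gt0.
apply: (has_iterated_integral_eq (@measurableT _ T) mD1 mD2) => w theta phi _ _ _.
by rewrite Re_cross.
Qed.

Let valid_shift l (j : 'I_(2 * l).+1) : valid_lm l (j%:Z - l%:Z).
Proof.
rewrite /valid_lm lerBrDr addNr le0z_nat /= lerBlDr -PoszD lez_nat addnn -mul2n.
by rewrite -ltnS.
Qed.

(** The integrand is the real part of [Z_l] times the conjugate of [Z_l']; in the double sum over
    orders only the [2 * l + 1] diagonal terms contribute. *)
Lemma iterated_harm_cross l l' :
  iterated (fun w theta phi =>
    (complex.Re (harm a l w theta phi) * complex.Re (harm a l' w theta phi) +
     complex.Im (harm a l w theta phi) * complex.Im (harm a l' w theta phi)) * sin theta)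
    (if l == l' then (2 * l + 1)%:R * Cl l else 0).
Proof.
have mD1 : measurable Dth by exact: measurable_itv.
have mD2 : measurable Dph by exact: measurable_itv.
have H := has_iterated_integral_sum (@measurableT _ T) mD1 mD2 (index_enum 'I_(2 * l).+1)
  (fun j => has_iterated_integral_sum (@measurableT _ T) mD1 mD2 (index_enum 'I_(2 * l').+1)
    (fun j' => iterated_Ylm (valid_shift j) (valid_shift j'))).
have vE : \sum_(j < (2 * l).+1) \sum_(j' < (2 * l').+1)
    (if (l == l') && (j%:Z - l%:Z == j'%:Z - l'%:Z) then Cl l else 0) =
    if l == l' then (2 * l + 1)%:R * Cl l else 0.
  case: eqVneq => [<-|ll'] /=; last by rewrite big1 // => i _; rewrite big1.
  transitivity (\sum_(j < (2 * l).+1) Cl l); last by rewrite sumr_const card_ord addn1 mulr_natl.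
  apply: eq_bigr => j _; rewrite (bigD1 j) //= eqxx big1 ?addr0 // => j' j'j.
  by case: eqP => // /addIr [] /ord_inj E; rewrite E eqxx in j'j.
rewrite vE in H.
apply: (has_iterated_integral_eq (@measurableT _ T) mD1 mD2 _ H) => w theta phi _ _ _.
transitivity (complex.Re (harm a l w theta phi * conjc (harm a l' w theta phi))
  * sin theta); last first.
  by case: (harm a l _ _ _) (harm a l' _ _ _) => x y [x' y'] /=; congr (_ * _); ring.
rewrite /harm rmorph_sum mulr_suml Re_sum mulr_suml; apply: eq_bigr => j _.
by rewrite mulr_sumr Re_sum mulr_suml.
Qed.

Lemma iterated_harm_comb (p : nat -> R) n :
  iterated (fun w theta phi =>
    (series (fun l => p l * complex.Re (harm a l w theta phi)) n ^+ 2 +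
     series (fun l => p l * complex.Im (harm a l w theta phi)) n ^+ 2) * sin theta)
    (\sum_(0 <= l < n) p l ^+ 2 * ((2 * l + 1)%:R * Cl l)).
Proof.
have mD1 : measurable Dth by exact: measurable_itv.
have mD2 : measurable Dph by exact: measurable_itv.
have H := has_iterated_integral_sum (@measurableT _ T) mD1 mD2 (index_enum 'I_n)
  (fun l : 'I_n => has_iterated_integral_sum (@measurableT _ T) mD1 mD2 (index_enum 'I_n)
    (fun l' : 'I_n => has_iterated_integralZ (@measurableT _ T) mD1 mD2 (p l * p l')
       (iterated_harm_cross l l'))).
have vE : \sum_(l < n) \sum_(l' < n)
    p l * p l' * (if l == l' :> nat then (2 * l + 1)%:R * Cl l else 0) =
    \sum_(0 <= l < n) p l ^+ 2 * ((2 * l + 1)%:R * Cl l).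
  rewrite big_mkord; apply: eq_bigr => l _; rewrite (bigD1 l) //= eqxx big1 ?addr0 ?expr2 //.
  by move=> l' l'l; case: eqP => [/ord_inj E|_]; [rewrite E eqxx in l'l|rewrite mulr0].
rewrite vE in H.
apply: (has_iterated_integral_eq (@measurableT _ T) mD1 mD2 _ H) => w theta phi _ _ _.
rewrite /series /= !expr2 !big_mkord !big_distrlr /= -big_split mulr_suml.
apply: eq_bigr => l _ /=; rewrite -big_split mulr_suml; apply: eq_bigr => l' _ /=; ring.
Qed.

End harmonic_orthogonality.

(** * Increments of the solution *)

Section solution.
Context {R : realType} (c D k : R).
Hypotheses (c0 : 0 < c) (D0 : 0 < D) (k0 : 0 < k).

(** By [Ylm00], [sqrt (4 pi / (2l+1))] and the value of [Y_l0] at the pole are inverse to each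
    other. *)
Lemma xi_lmE (alm : nat -> int -> R[i]) l m t :
  xi_lm c D k alm l m t = ((A_l c D k l t + B_l c D k l t) +i* 0)%C * alm l m.
Proof.
rewrite /xi_lm Ylm00; move: (A_l _ _ _ _ _ + _) => Phi.
have n0 : (2 * l + 1)%:R != 0 :> R by rewrite pnatr_eq0 addn1.
have pi0 : @pi R != 0 by rewrite gt_eqF ?pi_gt0.
have s1 : Num.sqrt (4 * pi / (2 * l + 1)%:R) * Num.sqrt ((2 * l + 1)%:R / (4 * pi)) = 1 :> R.
  rewrite -sqrtrM ?divr_ge0 ?mulr_ge0 ?pi_ge0 // mulrA mulfVK // divff ?sqrtr1 //.
  by rewrite mulf_neq0.
move: (Num.sqrt _) (Num.sqrt _) s1 => r s rs; have sE z : s * z * r * Phi = Phi * z.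
  by rewrite -[RHS]mulr1 -rs; ring.
case: (alm l m) => x y; apply/eqP; rewrite eq_complex /=.
by rewrite !(mul0r, mulr0, subr0, addr0, oppr0, add0r) !sE !eqxx.
Qed.

Let amp l t := A_l c D k l t + B_l c D k l t.

Lemma u_partialE {T : Type} (a : nat -> int -> T -> R[i]) w L theta phi t :
  u_partial c D k (fun l m => a l m w) L theta phi t =
  \sum_(l < L) (amp l t +i* 0)%C * harm a l w theta phi.
Proof.
apply: eq_bigr => l _; rewrite /harm mulr_sumr; apply: eq_bigr => j _.
by rewrite xi_lmE mulrCA.
Qed.

Section pointwise.
Context {T : Type} (a : nat -> int -> T -> R[i]) (w : T) (theta phi : R).
Let x l := complex.Re (harm a l w theta phi).
Let y l := complex.Im (harm a l w theta phi).
Let q l := (2 * l + 1)%:R ^+ 2 * (x l ^+ 2 + y l ^+ 2).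

Let Re_u_partial t : (fun L => complex.Re (u_partial c D k (fun l m => a l m w) L theta phi t)) =
  series (fun l => amp l t * x l).
Proof.
apply/funext => L; rewrite u_partialE Re_sum /series /= big_mkord.
by apply: eq_bigr => l _; rewrite /x; case: (harm _ _ _ _ _) => u v /=; rewrite mul0r subr0.
Qed.

Let Im_u_partial t : (fun L => complex.Im (u_partial c D k (fun l m => a l m w) L theta phi t)) =
  series (fun l => amp l t * y l).
Proof.
apply/funext => L; rewrite u_partialE Im_sum /series /= big_mkord.
by apply: eq_bigr => l _; rewrite /y; case: (harm _ _ _ _ _) => u v /=; rewrite mul0r addr0.
Qed.

Let E t := expR (- (c ^+ 2 * t) / (2 * D)).

(** Undoing the damping in [mode_bound] costs a factor depending on [t] only, so the bound stays
    uniform in [l]. *)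
Let amp_bound l t : 0 <= t -> `|amp l t| <= (1 + c ^+ 2 / (2 * D) * t) / E t.
Proof.
move=> t0; rewrite ler_pdivlMr ?expR_gt0 //.
apply: le_trans (_ : `|mode c D k l t| <= _); last by apply: mode_bound.
by rewrite /mode normrM (ger0_norm (expR_ge0 _)) mulrC.
Qed.

Let cvg_mode (z : nat -> R) t : cvgn (series (fun l => amp l t * z l)) ->
  series (fun l => mode c D k l t * z l) @ \oo --> E t * limn (series (fun l => amp l t * z l)).
Proof.
move=> cz; have -> : series (fun l => mode c D k l t * z l) =
    (fun n => E t * series (fun l => amp l t * z l) n).
  apply/funext => n; rewrite /series /= mulr_sumr; apply: eq_bigr => l _.
  by rewrite mulrA.
by apply: cvgM; [exact: cvg_cst|exact: cz].
Qed.

(** [u_sol] takes [lim] of undamped partial sums, an actual limit only once they converge.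
    Summability of [q] ensures this, and the damping then passes inside the limit. *)
Lemma cvg_u_sol t : 0 <= t -> cvgn (series q) ->
  series (fun l => mode c D k l t * x l) @ \oo -->
    complex.Re (u_sol c D k (fun l m => a l m w) theta phi t) /\
  series (fun l => mode c D k l t * y l) @ \oo -->
    complex.Im (u_sol c D k (fun l m => a l m w) theta phi t).
Proof.
move=> t0 cq; have bt l := amp_bound l t0.
have cx : cvgn (series (fun l => amp l t * x l)) by exact: is_cvg_weighted_sqr cq bt.
have cy : cvgn (series (fun l => amp l t * y l)).
  apply: (@is_cvg_weighted_sqr _ y x _ _ _ bt).
  by rewrite /q in cq; under eq_fun do rewrite addrC.
rewrite /u_sol Re_u_partial Im_u_partial /= !mul0r subr0 addr0.
by split; exact: cvg_mode.
Qed.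

Definition u_sol_increment t h :=
  u_sol c D k (fun l m => a l m w) theta phi (t + h)
  - u_sol c D k (fun l m => a l m w) theta phi t.

Lemma u_sol_increment_le t h : 0 <= t -> 0 < h -> 0 <= sin theta ->
  (((complex.Re (u_sol_increment t h) ^+ 2 + complex.Im (u_sol_increment t h) ^+ 2)
      * sin theta)%:E <= limn_einf (fun n =>
     (((series (fun l => (mode c D k l (t + h) - mode c D k l t) * x l) n ^+ 2 +
        series (fun l => (mode c D k l (t + h) - mode c D k l t) * y l) n ^+ 2)
       + h ^+ 2 * series q n) * sin theta)%:E))%E.
Proof.
move=> t0 h0 s0; apply: le_limn_einf_penalized => // cq.
have th0 : 0 <= t + h by rewrite addr_ge0 // ltW.
have [x1 y1] := cvg_u_sol th0 cq; have [x2 y2] := cvg_u_sol t0 cq.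
have pE (z : nat -> R) :
    series (fun l => (mode c D k l (t + h) - mode c D k l t) * z l) = (fun n =>
    series (fun l => mode c D k l (t + h) * z l) n - series (fun l => mode c D k l t * z l) n).
  apply/funext => n; rewrite /series /= -sumrB; apply: eq_bigr => l _.
  by rewrite mulrBl.
rewrite !pE /u_sol_increment; split.
  rewrite (_ : complex.Re _ = complex.Re (u_sol c D k (fun l m => a l m w) theta phi (t + h))
    - complex.Re (u_sol c D k (fun l m => a l m w) theta phi t)); first exact: (cvgB x1 x2).
  by case: (u_sol _ _ _ _ _ _ _) (u_sol _ _ _ _ _ _ _) => ? ? [].
rewrite (_ : complex.Im _ = complex.Im (u_sol c D k (fun l m => a l m w) theta phi (t + h))
  - complex.Im (u_sol c D k (fun l m => a l m w) theta phi t)); first exact: (cvgB y1 y2).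
by case: (u_sol _ _ _ _ _ _ _) (u_sol _ _ _ _ _ _ _) => ? ? [].
Qed.

End pointwise.
End solution.

(** * The bound in L2 *)

Lemma esqrt_le {R : realType} (x : \bar R) (y : R) : 0 <= y ->
  (x <= (y ^+ 2)%:E)%E -> (esqrt x <= y%:E)%E.
Proof.
move=> y0; case: x => [r| |]; [|by []|by move=> _; exact: leNye].
by rewrite /= !lee_fin => ry; rewrite -[leRHS]ger0_norm // -sqrtr_sqr ler_wsqrtr.
Qed.

(** The constant collects the squared Lipschitz constant and a 1 from the penalty, whose weight
    [h ^+ 2] has the order of the squared increment. It is uniform in the time and the probability
    space. *)
Lemma L2norm_increment_le {R : realType} (c D k : R) (c0 : 0 < c) (D0 : 0 < D) (k0 : 0 < k)
  (Cl : nat -> R)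
  (hCl : cvgn (series (fun l : nat => ((2 * l + 1) ^ 3)%:R * Cl l)))
  (d : measure_display) (T : measurableType d) (P : probability T R)
  (a : nat -> int -> T -> R[i]) (Ha : isotropic_gaussian_coeffs P Cl a) (t h : R) :
  0 <= t -> 0 < h ->
  (L2norm_OmegaS2 P (fun w theta phi => u_sol_increment c D k a w theta phi t h)
    <= (Num.sqrt (((c ^+ 2 / D + c * k) ^+ 2 + 1) *
          limn (series (fun l : nat => ((2 * l + 1) ^ 3)%:R * Cl l))) * h)%:E)%E.
Proof.
move=> t0 h0; set M := c ^+ 2 / D + c * k; set S := limn _.
pose p l := mode c D k l (t + h) - mode c D k l t.
have Cl0 l : 0 <= Cl l := spectrum_ge0 Ha l.
have SS n : \sum_(0 <= l < n) ((2 * l + 1) ^ 3)%:R * Cl l <= S.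
  apply: (@nondecreasing_cvgn_le _ (series (fun l : nat => ((2 * l + 1) ^ 3)%:R * Cl l))) => //.
  by apply/nondecreasing_seqP => m; rewrite seriesSr lerDl mulr_ge0.
have S0 : 0 <= S by apply: le_trans (SS 0%N); rewrite big_geq.
have B0 : 0 <= (M ^+ 2 + 1) * S by rewrite mulr_ge0 // addr_ge0 ?sqr_ge0.
apply: esqrt_le; first by rewrite mulr_ge0 ?sqrtr_ge0 // ltW.
rewrite exprMn sqr_sqrtr //.
pose Dth : set (measurableTypeR R) := `[0, pi[%classic.
pose Dph : set (measurableTypeR R) := `[0, (2 * pi)[%classic.
have mD1 : measurable Dth by exact: measurable_itv.
have mD2 : measurable Dph by exact: measurable_itv.
pose q w theta phi l : R := (2 * l + 1)%:R ^+ 2 *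
  (complex.Re (harm a l w theta phi) ^+ 2 + complex.Im (harm a l w theta phi) ^+ 2).
pose G n w theta phi := (((series (fun l => p l * complex.Re (harm a l w theta phi)) n ^+ 2 +
        series (fun l => p l * complex.Im (harm a l w theta phi)) n ^+ 2)
       + h ^+ 2 * series (q w theta phi) n) * sin theta).
(* The triple integral of [G n]: the increments by [iterated_harm_comb], the penalty by the diagonal
   case of [iterated_harm_cross]. *)
pose v n := \sum_(0 <= l < n) p l ^+ 2 * ((2 * l + 1)%:R * Cl l) +
  h ^+ 2 * \sum_(l < n) (2 * l + 1)%:R ^+ 2 * ((2 * l + 1)%:R * Cl l).
have sinD theta : Dth theta -> 0 <= sin theta.
  rewrite /Dth /= in_itv /= => /andP[th0 thpi]; apply: sin_ge0_pi.
  by rewrite th0 ltW.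
apply: (@iterated_fatou _ _ _ _ _ _ R P lebesgue_measure lebesgue_measure setT Dth Dph
  measurableT mD1 mD2 _ G v).
- move=> n.
  have H1 := iterated_harm_comb Ha p n.
  have H2 := has_iterated_integral_sum (@measurableT _ T) mD1 mD2 (index_enum 'I_n)
    (fun l : 'I_n => has_iterated_integralZ (@measurableT _ T) mD1 mD2 ((2 * l + 1)%:R ^+ 2)
       (iterated_harm_cross Ha l l)).
  have H3 := has_iterated_integralD (@measurableT _ T) mD1 mD2 H1
    (has_iterated_integralZ (@measurableT _ T) mD1 mD2 (h ^+ 2) H2).
  rewrite (eq_bigr (fun l : 'I_n => (2 * l + 1)%:R ^+ 2 * ((2 * l + 1)%:R * Cl l))) in H3;
    last by move=> l _; rewrite eqxx.
  apply: (has_iterated_integral_eq (@measurableT _ T) mD1 mD2 _ H3) => w theta phi _ _ _.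
  rewrite /G [RHS]mulrDl; congr (_ + _); rewrite -[RHS]mulrA; congr (_ * _).
  rewrite /series /= big_mkord mulr_suml; apply: eq_bigr => l _.
  by rewrite /q !expr2 mulrA.
- move=> n; rewrite /v.
  (* The increments take the first summand, the penalty the second. In both, two powers of
     [2 * l + 1] join the squared norm [(2 * l + 1) * Cl l] and give the cube. *)
  have -> : (M ^+ 2 + 1) * S * h ^+ 2 = M ^+ 2 * h ^+ 2 * S + h ^+ 2 * S by ring.
  rewrite lerD //; last first.
    rewrite ler_wpM2l ?sqr_ge0 //; apply: le_trans (SS n); rewrite big_mkord.
    by apply: ler_sum => l _; rewrite mulrA -exprSr natrX.
  apply: le_trans (_ : M ^+ 2 * h ^+ 2 * (\sum_(0 <= l < n) ((2 * l + 1) ^ 3)%:R * Cl l) <= _).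
    rewrite mulr_sumr; apply: ler_sum => l _.
    have -> : M ^+ 2 * h ^+ 2 * (((2 * l + 1) ^ 3)%:R * Cl l) =
      (M * (2 * l + 1)%:R * h) ^+ 2 * ((2 * l + 1)%:R * Cl l).
      by rewrite natrX; ring.
    rewrite ler_wpM2r // ?mulr_ge0 // -[leLHS]real_normK ?num_real //.
    have th : t <= t + h by rewrite lerDl ltW.
    have pl : `|p l| <= M * (2 * l + 1)%:R * h.
      by apply: le_trans (mode_lipschitz c0 D0 k0 l t0 th) _; rewrite addrAC subrr add0r.
    by rewrite lerXn2r // nnegrE (le_trans (normr_ge0 _) pl).
  by rewrite ler_wpM2l // mulr_ge0 ?sqr_ge0.
- move=> n w theta phi _ th _; rewrite /G mulr_ge0 ?sinD // addr_ge0 //.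
    by rewrite addr_ge0 ?sqr_ge0.
  rewrite mulr_ge0 ?sqr_ge0 // /series /= sumr_ge0 // => l _.
  by rewrite /q mulr_ge0 ?sqr_ge0 // addr_ge0 ?sqr_ge0.
- move=> w theta phi _ th _; rewrite lee_fin mulr_ge0 ?sinD //.
  by rewrite addr_ge0 ?sqr_ge0.
- move=> w theta phi _ th _; exact: u_sol_increment_le (sinD _ th).
Qed.

Unset Implicit Arguments.
Set Strict Implicit.

Theorem theorem4 (R : realType) (c D k : R) (hc : 0 < c) (hD : 0 < D) (hk : 0 < k)
  (Cl : nat -> R)
  (hCl : cvg (series (fun l : nat => ((2 * l + 1) ^ 3)%:R * Cl l) @ \oo)) :
  exists Cst : R,
    forall (d : measure_display) (T : measurableType d) (P : probability T R)
      (a : nat -> int -> T -> R[i]),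
      isotropic_gaussian_coeffs P Cl a ->
      forall t : R, 0 < t ->
        \forall h \near 0^'+,
          (L2norm_OmegaS2 P
             ((fun w theta phi =>
                u_sol c D k (fun l m => a l m w) theta phi (t + h)
                - u_sol c D k (fun l m => a l m w) theta phi t)%R)
           <= (Cst * h)%:E)%E.
Proof.
exists (Num.sqrt (((c ^+ 2 / D + c * k) ^+ 2 + 1) *
  limn (series (fun l : nat => ((2 * l + 1) ^ 3)%:R * Cl l)))).
move=> d T P a Ha t t0; near=> h.
by apply: (L2norm_increment_le hc hD hk hCl Ha (ltW t0)); near: h; exact: nbhs_right_gt.
Unshelve. all: by end_near.
Qed.
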